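(* Let $N$ be a positive integer and let $Y=(1,2,\dots,N)$ (the step initial condition). Let $x\in\mathbb{Z}$ and $t\ge 0$. Consider the TASEP with second class particles started from the state $(Y,21\cdots1)$, and let $E_t$ be the event that at time $t$ the species word is $21\cdots1$ and the leftmost particle is at $x$, i.e. $E_t=\{(X,21\cdots1;t)\colon x_1=x\}$. Let $C$ be a counterclockwise circle centered at the origin with radius less than $1$. Then $$\mathbb{P}_{(Y,21\cdots1)}(E_t)=\frac{(-1)^{N(N-1)/2}}{N!}\Big(\frac{1}{2\pi i}\Big)^N\oint_C\cdots\oint_C \prod_{1\le i<j\le N}(\xi_j-\xi_i)^2\ \prod_{i=1}^N\frac{1}{(\xi_i-1)^{N-1}}\ \prod_{i=1}^N\Big(\xi_i^{x-N-1}e^{\varepsilon(\xi_i)t}\Big)\,d\xi_1\cdots d\xi_N,$$ where $\varepsilon(\xi_i)=1/\xi_i-1$.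
   Context: The TASEP with second class particles (with $N$ particles) is the continuous-time Markov process defined as follows. Each site of $\mathbb{Z}$ is occupied by at most one particle and each particle belongs to species $1$ or species $2$. Particles of species $1$ are called second class particles and particles of species $2$ are called first class particles. Each particle, located at $z$ say, tries to jump to $z+1$ after an exponentially distributed waiting time of rate $1$ (independently for all particles). If $z+1$ is empty, the particle jumps to $z+1$. If $z+1$ is occupied by a particle of the same species, the jump is forbidden and the waiting time is reset. If the particle at $z$ is of species $2$ and $z+1$ is occupied by a particle of species $1$, the two particles interchange positions. If the particle at $z$ is of species $1$ and $z+1$ is occupied by a particle of species $2$, the jump is forbidden and the waiting time is reset. A state is a pair $(X,\pi)$ with $X=(x_1,\dots,x_N)\in\mathbb{Z}^N$, $x_1<\cdots<x_N$, and $\pi=\pi_1\cdots\pi_N$ a word in $\{1,2\}$; it means that the $i$-th particle from the left is at $x_i$ and is of species $\pi_i$. The notation $(X,\pi;t)$ means the state at time $t$ is $(X,\pi)$. $\mathbb{P}_{(Y,\nu)}$ is the probability measure of the process with initial state $(Y,\nu)$. *)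

(* Defs.v *)
From HB Require Import structures.
From mathcomp Require Import all_boot all_order all_algebra all_fingroup.
From mathcomp Require Import all_classical all_reals all_analysis.
From mathcomp Require Import complex.

Set Implicit Arguments.
Unset Strict Implicit.
Unset Printing Implicit Defensive.

Import Order.TTheory GRing.Theory Num.Theory.
Import numFieldNormedType.Exports.

Local Open Scope classical_set_scope.
Local Open Scope ring_scope.
Local Open Scope complex_scope.

(* [sp1] (species 1) is a second class particle, [sp2] (species 2) a first
   class one. *)
Inductive species := sp1 | sp2.

Definition bool_of_species (a : species) : bool :=
  if a is sp2 then true else false.
Definition species_of_bool (b : bool) : species := if b then sp2 else sp1.
Lemma bool_of_speciesK : cancel bool_of_species species_of_bool.
Proof. by case. Qed.
HB.instance Definition _ := Finite.copy species (can_type bool_of_speciesK).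

Definition config (N : nat) := (N.-tuple int * N.-tuple species)%type.

Record state (N : nat) := State {
  state_val :> config N;
  state_sorted : sorted <%R state_val.1
}.
HB.instance Definition _ N := [isSub for @state_val N].
HB.instance Definition _ N := [Countable of state N by <:].

Definition positions N (s : state N) : N.-tuple int := (val s).1.
Definition word N (s : state N) : N.-tuple species := (val s).2.

(* What happens when the clock of the [i]-th particle from the left rings.
   When two particles interchange positions, the set of occupied sites, hence
   the ordered vector [X], is unchanged, and the [i]-th and [j]-th letters of
   the word are exchanged. *)
Definition attempt N (i : 'I_N) (s : config N) : config N :=
  let: (X, w) := s in
  if [pick j | tnth X j == tnth X i + 1] is Some j then
    if (tnth w i == sp2) && (tnth w j == sp1)
    then (X, [tuple tnth w (tperm i j k) | k < N])
    else (X, w)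
  else ([tuple if k == i then tnth X i + 1 else tnth X k | k < N], w).

(* Entries of the generator [f |-> (s |-> \sum_i (f (attempt i s) - f s))]: each
   particle independently makes an attempt at rate 1, and a forbidden attempt
   contributes nothing. *)
Definition tasep_rate (R : realType) N (s s' : state N) : R :=
  \sum_(i < N) ((attempt i (val s) == val s')%:R - (s == s')%:R).

Definition transition_function (R : realType) (S : countType)
    (Q : S -> S -> R) (p : R -> S -> S -> R) : Prop :=
  [/\ (forall (t : R) s s', 0 <= t -> 0 <= p t s s'),
      (forall (t : R) s, 0 <= t -> \esum_(s' in [set: S]) (p t s s')%:E = 1%E),
      (forall (t u : R) s s', 0 <= t -> 0 <= u ->
         \esum_(r in [set: S]) (p t s r * p u r s')%:E = (p (t + u) s s')%:E),
      (forall s s', p 0 s s' = (s == s')%:R) &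
      (forall s s',
         h^-1 * (p h s s' - (s == s')%:R) @[h --> 0^'+] --> Q s s')].

(* Time-homogeneous continuous-time Markov process with generator matrix [Q]
   started from [s0]; [hist] is a finite list of pairs (time, state). *)
Definition markov_process (R : realType) (d : measure_display)
    (Omega : measurableType d) (P : probability Omega R) (S : countType)
    (Q : S -> S -> R) (s0 : S) (eta : R -> Omega -> S) : Prop :=
  [/\ (forall (t : R) s, 0 <= t -> measurable [set w | eta t w = s]),
      P [set w | eta 0 w = s0] = 1%E &
      exists2 p, transition_function Q p &
        forall (hist : seq (R * S)) (t h : R) (s s' : S),
          0 <= t -> 0 <= h -> all (fun us : R * S => 0 <= us.1 <= t) hist ->
          let past := [set w | forall us, us \in hist -> eta us.1 w = us.2] in
          P (past `&` [set w | eta t w = s] `&` [set w | eta (t + h) w = s'])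
          = (P (past `&` [set w | eta t w = s]) * (p h s s')%:E)%E].

Definition tasep (R : realType) (d : measure_display)
    (Omega : measurableType d) (P : probability Omega R) N (s0 : state N)
    (eta : R -> Omega -> state N) : Prop :=
  markov_process P (@tasep_rate R N) s0 eta.

Definition step (N : nat) : N.-tuple int := [tuple (val i).+1%:Z | i < N].

Definition word21 (N : nat) : N.-tuple species :=
  [tuple if val i == 0%N then sp2 else sp1 | i < N].

Lemma step_sorted N : sorted <%R (step N).
Proof.
have -> : tval (step N) = [seq n.+1%:Z | n <- iota 0 N].
  by rewrite /= -val_enum_ord -map_comp; apply: eq_map.
rewrite sorted_map; apply: sub_sorted (iota_ltn_sorted 0 N) => m n /=.
by rewrite ltz_nat ltnS.
Qed.

Definition step_state N : state N := @State N (step N, word21 N) (step_sorted N).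

Definition cexp (R : realType) (z : R[i]) : R[i] :=
  (expR (complex.Re z))%:C * (cos (complex.Im z) +i* sin (complex.Im z)).

Definition cintegral (R : realType) (a b : R) (f : R -> R[i]) : R[i] :=
  Rintegral lebesgue_measure `[a, b] (fun u => complex.Re (f u)) +i*
  Rintegral lebesgue_measure `[a, b] (fun u => complex.Im (f u)).

(* Counterclockwise contour integral over the circle |z| = r, z = r e^(i u). *)
Definition circle_integral (R : realType) (r : R) (f : R[i] -> R[i]) : R[i] :=
  cintegral 0 (2 * pi) (fun u =>
    let z := r%:C * cexp ('i%C * u%:C) in f z * ('i%C * z)).

Fixpoint circle_integrals (R : realType) (r : R) (n : nat) :
    (n.-tuple R[i] -> R[i]) -> R[i] :=
  match n with
  | 0 => fun F => F [tuple]
  | m.+1 => fun F =>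
      circle_integral r (fun z => circle_integrals r (fun zs => F [tuple of z :: zs]))
  end.

Definition epsilon (R : realType) (z : R[i]) : R[i] := 1 / z - 1.

(* Main.v *)
(** Until the first class particle first overtakes a second class one, the
    positions evolve as a TASEP in which the leftmost particle is killed when it
    attempts to jump onto an occupied site.  The probability [v_s(t)] of being in
    [E_t] from a state [s] solves the backward equation [v_s' = sum_i (v_(a_i s)
    - v_s)], where [a_i s] is the state after a ring of clock [i].  For an
    arbitrary initial position [y] (with word 21...1) this equation and its
    initial condition are also solved by the Bethe-type determinant
    [det (c (x - y_i + j) (max (i - 1) 0 - j))], where [c k m] is 1/(2 pi i)
    times the integral of [z^(k-1) (1-z)^m exp(epsilon(z) t)]:
    [c k (m+1) = c k m - c (k+1) m] and [c'(k,m) = c (k-1) m - c k m] turn a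
    blocked jump into a row operation and a killing jump into a pair of equal
    rows.  Both solutions grow at most exponentially in [y], which forces them to
    agree.  At the step initial condition the determinant is, up to unitriangular
    row and column operations, the Hankel determinant that Andreief's identity
    produces from the squared Vandermonde determinant in the multiple
    integral. *)

Require Import Defs.
From HB Require Import structures.
From mathcomp Require Import all_boot all_order all_algebra all_fingroup.
From mathcomp Require Import all_classical all_reals all_analysis.
From mathcomp Require Import complex.
From mathcomp Require Import ring lra zify.

Import Order.TTheory GRing.Theory Num.Theory.
Import numFieldNormedType.Exports.

Local Open Scope classical_set_scope.
Local Open Scope ring_scope.
Local Open Scope complex_scope.

(** * Uniqueness for linear jump equations *)

(** For [e = 1] and [e = -1] the function [g - e f] starts at 0 and has nonnegative derivative on
    [(0, T]], so it stays nonnegative. Only right continuity is asked at 0 because transition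
    probabilities are meaningful for nonnegative times only. *)
Lemma derive_growth (R : realType) (f f' g g' : R -> R) (T : R) :
  f 0 = 0 -> g 0 = 0 ->
  f t @[t --> 0^'+] --> f 0 -> g t @[t --> 0^'+] --> g 0 ->
  (forall t : R, 0 < t -> is_derive t 1 f (f' t)) ->
  (forall t : R, 0 < t -> is_derive t 1 g (g' t)) ->
  (forall t, 0 < t -> t <= T -> `|f' t| <= g' t) ->
  forall t, 0 <= t -> t <= T -> `|f t| <= g t.
Proof.
move=> f0 g0 cf cg df dg fg t; rewrite le_eqVlt => /predU1P[<- _|t0 tT].
  by rewrite f0 g0 normr0.
have key (e : R) : `|e| = 1 -> e * f t <= g t.
  move=> e1.
  have dh (u : R) : 0 < u -> is_derive u 1 (g \- e \*: f) (g' u - e * f' u).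
    by move=> u0; have ? := df u u0; have ? := dg u u0; apply: is_deriveB.
  have ch (u : R) : 0 < u -> {for u, continuous (g \- e \*: f)}.
    move=> u0; apply/differentiable_continuous/derivable1_diffP.
    by have [] := dh u u0.
  have := @ger0_derive1_le_cc R (g \- e \*: f) 0 t.
  move=> /(_ _ _ _ 0 t); rewrite /= f0 g0 scaler0 subr0 subr_ge0.
  apply.
  - by move=> u; rewrite in_itv/= => /andP[u0 _]; have [] := dh u u0.
  - move=> u; rewrite in_itv/= => /andP[u0 ut]; have ? := dh u u0.
    rewrite derive1E derive_val subr_ge0 (le_trans (ler_norm _))// normrM e1.
    by rewrite mul1r fg// (le_trans (ltW ut)).
  - apply/(continuous_within_itvP _ t0); split.
    + by move=> u; rewrite in_itv/= => /andP[u0 _]; apply: ch.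
    + by apply: cvgB cg _; apply: cvgM cf; exact: cvg_cst.
    + exact/cvg_at_left_filter/ch.
  - by rewrite in_itv/= lexx ltW.
  - by rewrite in_itv/= lexx ltW.
  - exact: ltW.
rewrite ler_norml lerNl -mulN1r key ?normrN1//=.
by rewrite -[f t]mul1r key// normr1.
Qed.

(* Iterating the integral form of the equation gives
   [|D s t| <= A K ^ wt s (C t) ^ m / m!] for every [m]. *)
Lemma jump_equation_unique (R : realType) (S : Type) (n : nat)
    (a : 'I_n -> S -> S) (wt : S -> nat) (D : S -> R -> R) (T A K : R) :
  (forall i s, (wt (a i s) <= (wt s).+1)%N) -> 0 <= A -> 1 <= K ->
  (forall s, D s 0 = 0) -> (forall s, D s t @[t --> 0^'+] --> D s 0) ->
  (forall s (t : R), 0 < t ->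
     is_derive t 1 (D s) (\sum_(i < n) (D (a i s) t - D s t))) ->
  (forall s t, 0 <= t -> t <= T -> `|D s t| <= A * K ^+ wt s) ->
  forall s t, 0 <= t -> t <= T -> D s t = 0.
Proof.
move=> wtS A0 K1 D0 Dc dD Dle s t t0 tT.
have K0 : 0 <= K by apply: le_trans K1.
(* Each of the [n] terms [D (a i s) - D s] costs a factor [K] for the jump, which raises the weight
   by at most one, plus 1 for the state itself. *)
pose C := n%:R * (K + 1).
have C0 : 0 <= C by rewrite mulr_ge0// addr_ge0.
have bound m : forall s' (u : R), 0 <= u -> u <= T ->
    `|D s' u| <= A * K ^+ wt s' * (exp_coeff (C * u) m).
  elim: m => [|m IH] s' u u0 uT.
    by rewrite /exp_coeff /= expr0 fact0 divr1 mulr1 Dle.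
  pose B := A * K ^+ wt s'.
  have B0 : 0 <= B by rewrite mulr_ge0// exprn_ge0.
  have E v : B * exp_coeff (C * v) m.+1 = (B * C ^+ m.+1 / (m.+1)`!%:R) * v ^+ m.+1.
    by rewrite /exp_coeff /= exprMn; ring.
  rewrite -/B E; pose b := B * C ^+ m.+1 / (m.+1)`!%:R.
  have g0 : b * 0 ^+ m.+1 = 0 by rewrite expr0n mulr0.
  have cg : b * v ^+ m.+1 @[v --> 0^'+] --> b * 0 ^+ m.+1.
    apply: cvgM; first exact: cvg_cst.
    by apply: cvg_at_right_filter; exact: exprn_continuous.
  have dg (v : R) : 0 < v ->
      is_derive v 1 (fun v => b * v ^+ m.+1) (C * (B * exp_coeff (C * v) m)).
    move=> v0; have h := is_deriveZ b
      (DeriveDef (@exprn_derivable R m.+1 v 1) (exp_derive m.+1 v 1)).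
    apply: (is_derive_eq h).
    rewrite /exp_coeff /= /b factS natrM (exprMn m C v) (exprS C) /GRing.scale /=.
    move: (C ^+ m) => Cm; by field; rewrite nat1r !pnatr_eq0 -lt0n fact_gt0.
  apply: (@derive_growth R (D s') _ (fun v => b * v ^+ m.+1) _ T (D0 s') g0
    (Dc s') cg (dD s') dg _ u u0 uT) => v v0 vT.
  rewrite (le_trans (ler_norm_sum _ _ _))//.
  apply: (@le_trans _ _ (\sum_(i < n) (K + 1) * (B * exp_coeff (C * v) m))).
    apply: ler_sum => i _; rewrite (le_trans (ler_normB _ _))// mulrDl mul1r.
    rewrite lerD ?(IH _ _ (ltW v0) vT)//.
    have e0 : 0 <= exp_coeff (C * v) m by rewrite exp_coeff_ge0// mulr_ge0// ltW.
    rewrite (le_trans (IH _ _ (ltW v0) vT))// mulrA ler_wpM2r// /B mulrCA.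
    by rewrite ler_wpM2l// -exprS ler_weXn2l.
  by rewrite sumr_const card_ord -mulr_natl mulrA.
apply/eqP; rewrite -normr_le0.
have lim : A * K ^+ wt s * exp_coeff (C * t) m @[m --> \oo] --> A * K ^+ wt s * 0.
  apply: cvgM; first exact: cvg_cst.
  exact: cvg_exp_coeff.
rewrite mulr0 in lim.
rewrite -(cvg_lim _ lim)//; apply: limr_ge.
  by apply/cvg_ex; eexists; exact: lim.
by near=> m; exact: bound.
Unshelve. all: end_near.
Qed.

(** * The determinant and its row operations *)

(** The first row has its only 1 in the last column; expanding there gives the sign [(-1) ^+ n] and
    the same matrix one size smaller. *)
Lemma det_antidiag (F : comNzRingType) n :
  \det (\matrix_(i < n, j < n) ((i + j).+1 == n)%:R : 'M[F]_n)
    = (-1) ^+ 'C(n, 2).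
Proof.
elim: n => [|n IH]; first by rewrite det_mx00.
rewrite (expand_det_row _ ord0) (bigD1 ord_max)//= mxE/= add0n eqxx mul1r.
rewrite big1 ?addr0 => [|j jmax]; last first.
  rewrite mxE add0n eqSS -(inj_eq val_inj)/= in jmax *.
  by rewrite (negbTE jmax) mul0r.
rewrite /cofactor add0n binS bin1 exprD [RHS]mulrC; congr (_ * _).
  rewrite -IH; congr (\det _); apply/matrixP => i j; rewrite !mxE /=.
  by rewrite /bump leq0n leqNgt ltn_ord add0n add1n addSn eqSS.
Qed.

Lemma det_coef_unitriangular (F : comNzRingType) n (Q : 'I_n -> {poly F}) :
  (forall i, (Q i)`_0 = 1) ->
  \det (\matrix_(i < n, j < n) ('X^i * Q i)`_j) = 1.
Proof.
move=> Q0; rewrite -det_tr det_trig.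
  by rewrite big1// => i _; rewrite !mxE coefXnM ltnn subnn.
by apply/is_trig_mxP => i j ij; rewrite !mxE coefXnM ij.
Qed.

Section determinant.
Context (F : comNzRingType) (n : nat).
Implicit Types (c : int -> int -> F) (x : int) (y : 'I_n.+1 -> int).

(** The predecessor is truncated, so rows 0 and 1 carry the same second argument [- j]. They differ
    only through [y], and this encodes the killing. *)
Definition killed_det c x y : F :=
  \det (\matrix_(i < n.+1, j < n.+1) c (x - y i + j%:Z) (i.-1%:Z - j%:Z)).

Definition raise y i : 'I_n.+1 -> int := fun k => if k == i then y i + 1 else y k.

Lemma killed_det_collision c x y (i : 'I_n.+1) :
  (i = 1 :> nat)%N -> y ord0 = y i -> killed_det c x y = 0.
Proof.
move=> i1 y01; apply: (@determinant_alternate _ _ _ ord0 i).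
  by rewrite -(inj_eq val_inj)/= i1.
by move=> j; rewrite !mxE y01 i1.
Qed.

(** By the recursion in [m], raising [y i] adds to row [i] exactly row [j] of the same matrix. [C]
    is the matrix with row [j] repeated at [i]. The condition [0 < i] makes the second arguments of
    the two rows differ by one in spite of the truncation. *)
Lemma killed_det_blocked c x y (i j : 'I_n.+1) :
  (forall k m, c k (m + 1) = c k m - c (k + 1) m) ->
  (0 < i)%N -> (j = i.+1 :> nat)%N -> y j = y i + 1 ->
  killed_det c x (raise y i) = killed_det c x y.
Proof.
move=> cS i0 ji yji.
pose C := \matrix_(k < n.+1, l < n.+1)
  c (x - y (if k == i then j else k) + l%:Z)
    ((if k == i then j else k).-1%:Z - l%:Z).
have ij : i != j by rewrite -(inj_eq val_inj)/= ji neq_ltn ltnSn.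
have C0 : \det C = 0.
  apply: (determinant_alternate ij) => l.
  by rewrite !mxE eqxx eq_sym (negbTE ij).
rewrite /killed_det; set A := (X in \det X); set B := (X in _ = \det X).
rewrite (@determinant_multilinear _ _ A B C i 1 1) ?C0 ?mulr0 ?addr0 ?mul1r//.
- apply/rowP => l; rewrite !mxE /raise eqxx !mul1r ji/= yji.
  have -> : i%:Z - l%:Z = (i.-1%:Z - l%:Z) + 1 by case: (val i) i0 => // k _; lia.
  have -> : x - y i + l%:Z = (x - (y i + 1) + l%:Z) + 1 by lia.
  by rewrite cS addrCA subrr addr0.
- by apply/matrixP => k l; rewrite !mxE /raise eq_sym (negbTE (neq_lift _ _)).
- by apply/matrixP => k l; rewrite !mxE /raise eq_sym (negbTE (neq_lift _ _)).
Qed.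

(** The hypotheses on [c] describe the coefficient of [z ^ (- k)] in the power series of
    [(1 - z) ^ m]. If [y ord0 < x], row 0 vanishes; if [x < y ord0], column 0 vanishes; in case of
    equality the matrix is upper triangular with unit diagonal. *)
Lemma killed_det_initial c x y :
  (forall k, c k 0 = (k == 0)%:R) -> (forall k m, 0 < k -> c k m = 0) ->
  (forall k, k <= 0 -> c k (- 1) = 1) ->
  (forall k (m : nat), k < - m%:Z -> c k m%:Z = 0) ->
  (forall i : 'I_n.+1, y ord0 + i%:Z <= y i) ->
  killed_det c x y = (y ord0 == x)%:R.
Proof.
move=> c0 cpos cN1 cneg yi; rewrite /killed_det.
(* Below the diagonal the power [i.-1 - j] of [1 - z] is nonnegative, and the gaps in [y] push the
   first argument past the degree of this polynomial. *)
have low (i j : 'I_n.+1) : (j < i)%N -> x <= y ord0 ->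
    c (x - y i + j%:Z) (i.-1%:Z - j%:Z) = 0.
  move=> ji xy; have -> : i.-1%:Z - j%:Z = (i.-1 - j)%:Z by lia.
  by apply: cneg; have := yi i; lia.
case: ltgtP => [yx|xy|yx].
- rewrite (expand_det_row _ ord0) big1// => j _.
  by rewrite mxE cpos ?mul0r//; lia.
- rewrite (expand_det_col _ ord0) big1// => i _; rewrite mxE.
  have [->|i0] := eqVneq i ord0; last by rewrite low ?mul0r ?lt0n// ltW.
  by rewrite /= subr0 c0 (_ : _ == _ = false) ?mul0r//; lia.
rewrite -det_tr det_trig.
  rewrite big1// => i _; rewrite !mxE -yx.
  have [->|i0] := eqVneq i ord0; first by rewrite /= subrr c0.
  rewrite (_ : i.-1%:Z - i%:Z = -1); first by rewrite cN1//; have := yi i; lia.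
  by move: i0; rewrite -(inj_eq val_inj)/=; lia.
by apply/is_trig_mxP => i j ij; rewrite !mxE low// yx.
Qed.

(** Under the integral, a factor [z] shifts [k] and a factor [1 - z] raises [m]. Hence combining
    shifts of [c] with the coefficients of [z ^ a (1 - z) ^ b] moves both arguments; [B] only has to
    exceed the degree. *)
Lemma coef_moment c (k m : int) (a b B : nat) :
  (forall k m, c k (m + 1) = c k m - c (k + 1) m) -> (a + b < B)%N ->
  \sum_(l < B) ('X^a * (1 - 'X) ^+ b : {poly F})`_l * c (k + l%:Z) m
    = c (k + a%:Z) (m + b%:Z).
Proof.
move=> cS; elim: b a => [|b IH] a.
  rewrite !addn0 expr0 mulr1 addr0 => aB.
  rewrite (bigD1 (Ordinal aB))//= coefXn eqxx mul1r big1 ?addr0// => l.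
  by rewrite -(inj_eq val_inj)/= coefXn => /negbTE ->; rewrite mul0r.
rewrite addnS => abB.
rewrite (_ : c _ _ = c (k + a%:Z) (m + b%:Z) - c (k + a.+1%:Z) (m + b%:Z)); last first.
  have -> : m + b.+1%:Z = m + b%:Z + 1 by lia.
  by rewrite cS; congr (_ - c _ _); lia.
rewrite -!IH; [|lia..].
rewrite -sumrB; apply: eq_bigr => l _; rewrite -mulrBl -coefB; congr (_ * _).
have -> : ('X^a * (1 - 'X) ^+ b.+1 : {poly F}) =
    'X^a * (1 - 'X) ^+ b - 'X^(a.+1) * (1 - 'X) ^+ b.
  by rewrite [(1 - _) ^+ b.+1]exprS exprSr; ring.
by [].
Qed.

Lemma killed_det_step c x :
  (forall k m, c k (m + 1) = c k m - c (k + 1) m) ->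
  killed_det c x (fun i => i.+1%:Z) = (-1) ^+ 'C(n.+1, 2) *
    \det (\matrix_(a < n.+1, b < n.+1) c (x - n.+1%:Z + (a + b)%:Z) (- n%:Z)).
Proof.
move=> cS; set H := \matrix_(a, b) _.
(* Row [n - i] of [A] and row [j] of [B] multiply the Hankel kernel by [z ^ (n - i) (1 - z) ^ i.-1]
   and [z ^ j (1 - z) ^ (n - j)], which turns its arguments into those of entry [(i, j)]. The
   reversal [J] is what makes [A] unitriangular, and it contributes the sign. *)
pose A : 'M[F]_n.+1 := \matrix_(i, a) ('X^i * (1 - 'X) ^+ (n - i).-1 : {poly F})`_a.
pose B : 'M[F]_n.+1 := \matrix_(j, b) ('X^j * (1 - 'X) ^+ (n - j) : {poly F})`_b.
pose J : 'M[F]_n.+1 := \matrix_(i, j) ((i + j).+1 == n.+1)%:R.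
have unit0 p : ((1 - 'X) ^+ p : {poly F})`_0 = 1.
  by rewrite -horner_coef0 !hornerE subr0 expr1n.
have detA : \det A = 1 by apply: det_coef_unitriangular => i; exact: unit0.
have detB : \det B = 1 by apply: det_coef_unitriangular => i; exact: unit0.
have -> : killed_det c x (fun i => i.+1%:Z) = \det (J *m (A *m H *m B^T)).
  congr (\det _); apply/matrixP => i j; rewrite !mxE.
  rewrite (bigD1 (rev_ord i))//= big1 ?addr0 => [|l li]; last first.
    rewrite mxE eqSS (_ : _ == _ = false) ?mul0r//.
    by move: li; rewrite -(inj_eq val_inj)/= subSS; have := ltn_ord i; lia.
  rewrite mxE /= eqSS subSS subnKC -1?ltnS// eqxx mul1r mxE.
  under eq_bigr do rewrite mxE mulr_suml.
  rewrite exchange_big /=.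
  under eq_bigr => a _.
    under eq_bigr => b _.
      rewrite !mxE /= subSS subKn -1?ltnS// -mulrA [c _ _ * _]mulrC PoszD addrA.
    over.
    rewrite -mulr_sumr coef_moment//; last by have := ltn_ord j; lia.
    rewrite (_ : _ + a%:Z + _ = x - n.+1%:Z + j%:Z + a%:Z); last by lia.
  over.
  rewrite coef_moment//; last by have := ltn_ord i; lia.
  by congr (c _ _); have := ltn_ord j; have := ltn_ord i; lia.
by rewrite !det_mulmx det_tr detA detB mul1r mulr1 det_antidiag.
Qed.
End determinant.

Arguments killed_det {F n} c x y.
Arguments raise {n} y i _.

(** * Transition functions of bounded jump chains *)

(** Bounding finite partial sums gives one inequality for every factor; used with [k^-1] it gives
    the converse when [k] is nonzero. *)
Lemma esumZl (R : realType) (S : choiceType) (D : set S) (k : R)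
    (a : S -> \bar R) : 0 <= k -> (forall i, 0 <= a i)%E ->
  (\esum_(i in D) (k%:E * a i) = k%:E * \esum_(i in D) a i)%E.
Proof.
move=> k0 a0.
have le (b : S -> \bar R) (u : R) : 0 <= u -> (forall i, 0 <= b i)%E ->
    (\esum_(i in D) (u%:E * b i) <= u%:E * \esum_(i in D) b i)%E.
  move=> u0 b0; apply: ge_ereal_sup => _ [X [finX XD] <-].
  rewrite -ge0_mule_fsumr//; apply: lee_wpmul2l; first by rewrite lee_fin.
  by apply: ereal_sup_ubound; exists X.
apply/eqP; rewrite eq_le le//=; have [->|kN0] := eqVneq k 0.
  by rewrite mul0e esum_ge0// => i _; rewrite mul0e.
have ka i : (0 <= k%:E * a i)%E by rewrite mule_ge0// lee_fin.
have kV : 0 <= k^-1 by rewrite invr_ge0.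
have := le _ _ kV ka.
under eq_esum => i _ do rewrite muleA -EFinM mulVf// mul1e.
move=> /(lee_wpmul2l (_ : 0 <= k%:E)%E).
by rewrite muleA -EFinM mulfV// mul1e; apply; rewrite lee_fin.
Qed.

Lemma esum_exchange (R : realType) (S T : choiceType) (A : set S) (B : set T)
    (f : S -> T -> \bar R) : (forall i j, 0 <= f i j)%E ->
  \esum_(i in A) \esum_(j in B) f i j = \esum_(j in B) \esum_(i in A) f i j.
Proof.
move=> f0; rewrite esum_esum// esum_esum//.
rewrite (reindex_esum (B `*`` (fun=> A)) (A `*`` (fun=> B)) (fun x => (x.2, x.1)))//.
split=> [[i j] [/= ? ?]//|[i j] [i' j'] _ _ [-> ->]//|[i j] [/= ? ?]].
by exists (j, i).
Qed.

Lemma is_derive_dnbhs (R : realType) (f : R -> R) (t l : R) :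
  h^-1 * (f (h + t) - f t) @[h --> 0^'] --> l -> is_derive t 1 f l.
Proof.
move=> fl.
have fl' : h^-1 *: ((f \o shift t) (h *: 1) - f t) @[h --> 0^'] --> l.
  apply: cvg_trans fl; apply: near_eq_cvg; near=> h.
  by rewrite /= /GRing.scale /= mulr1.
apply: DeriveDef; first by apply/cvg_ex; exists l.
exact: cvg_lim fl'.
Unshelve. all: end_near. Qed.

(** The forward expansion holds with an error independent of the base point. Taken at [t - h] it
    therefore controls the left difference quotient too, once [g (t - h)] is replaced by [g t] at
    the cost [w h]. *)
Lemma is_derive_uniform (R : realType) (f g e w : R -> R) (t : R) : 0 < t ->
  e h @[h --> 0^'+] --> 0 -> w h @[h --> 0^'+] --> 0 ->
  (forall u h : R, 0 <= u -> 0 < h -> `|f (u + h) - f u - h * g u| <= h * e h) ->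
  (forall h : R, 0 < h -> h < t -> `|g t - g (t - h)| <= w h) ->
  is_derive t 1 f (g t).
Proof.
move=> t0 e0 w0 fe gw; apply: is_derive_dnbhs.
have le (u h : R) : 0 <= u -> 0 < h -> `|h^-1 * (f (u + h) - f u) - g u| <= e h.
  move=> u0 h0; rewrite -(ler_pM2l h0) -{1}(gtr0_norm h0) -normrM mulrBr mulrA.
  by rewrite mulfV ?gt_eqF// mul1r fe.
apply: (@cvg_at_right_left_dnbhs _ R^o).
  apply/subr_cvg0/norm_cvg0P.
  apply: (@squeeze_cvgr _ _ _ _ (fun=> 0) e _ _ _ (cvg_cst _) e0).
  by near=> h; rewrite normr_ge0 /= (addrC h) le// ltW.
apply/cvg_at_leftNP; rewrite oppr0.
apply/subr_cvg0/norm_cvg0P.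
apply: (@squeeze_cvgr _ _ _ _ (fun=> 0) (e \+ w) _ _ _ (cvg_cst _)).
  near=> h; rewrite normr_ge0/=.
  have h0 : 0 < h by near: h; exact: nbhs_right_gt.
  have ht : h < t by near: h; exact: nbhs_right_lt.
  rewrite (_ : _ - g t = (h^-1 * (f (t - h + h) - f (t - h)) - g (t - h))
     - (g t - g (t - h))); last first.
    by rewrite subrK (addrC (-h)) invrN; ring.
  by rewrite (le_trans (ler_normB _ _))// lerD ?gw// le// subr_ge0 ltW.
by rewrite -[X in _ --> X]addr0; exact: cvgD.
Unshelve. all: end_near. Qed.
Lemma cvg_sum_seq (R : realType) (T : Type) (F : set_system T) {FF : Filter F}
    (I : Type) (r : seq I) (f : I -> T -> R) (l : I -> R) :
  (forall i, f i x @[x --> F] --> l i) ->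
  \sum_(i <- r) f i x @[x --> F] --> \sum_(i <- r) l i.
Proof. by move=> fl; apply: cvg_big => // x; exact: add_continuous. Qed.

Section jump_chain.
Context (R : realType) (S : countType) (n : nat) (a : 'I_n -> S -> S).
Context (p : R -> S -> S -> R) (E : set S).
Hypothesis hp : transition_function
  (fun s s' => \sum_(i < n) ((a i s == s')%:R - (s == s')%:R)) p.

(** The probability of being in [E] at time [t], not of having visited it earlier. For [0 <= t] the
    sum is at most 1, so [fine] loses nothing. *)
Definition hit (s : S) (t : R) : R := fine (\esum_(s' in E) (p t s s')%:E).

Let p_ge0 (t : R) s s' : 0 <= t -> 0 <= p t s s'.
Proof. by case: hp => + _ _ _ _; exact. Qed.

Let p_sum (t : R) s : 0 <= t -> \esum_(s' in [set: S]) (p t s s')%:E = 1%E.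
Proof. by case: hp => _ + _ _ _; exact. Qed.

Let esum_hit_le1 s t : 0 <= t -> (\esum_(s' in E) (p t s s')%:E <= 1)%E.
Proof.
move=> t0; rewrite -(p_sum t s t0) [leRHS](esumID E) => [|r _]; last first.
  by rewrite lee_fin p_ge0.
by rewrite setTI leeDl// esum_ge0// => r _; rewrite lee_fin p_ge0.
Qed.

Lemma hitE s (t : R) : 0 <= t ->
  (hit s t)%:E = \esum_(s' in E) (p t s s')%:E.
Proof.
move=> t0; rewrite fineK// fin_real//.
rewrite (lt_le_trans (ltNyr 0)) ?esum_ge0// => [|r _]; last first.
  by rewrite lee_fin p_ge0.
by rewrite (le_lt_trans (esum_hit_le1 s t t0))// ltry.
Qed.

Lemma hit_ge0 s (t : R) : 0 <= t -> 0 <= hit s t.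
Proof.
by move=> t0; rewrite fine_ge0// esum_ge0// => r _; rewrite lee_fin p_ge0.
Qed.

Lemma hit_le1 s (t : R) : 0 <= t -> hit s t <= 1.
Proof. by move=> t0; rewrite -lee_fin hitE// esum_hit_le1. Qed.

Lemma hit0 s : hit s 0 = (s \in E)%:R.
Proof.
case: hp => _ _ _ p0 _; apply: EFin_inj; rewrite hitE//.
under eq_esum do rewrite p0; have [sE|sE] := boolP (s \in E).
  rewrite (esumID [set s]) => [|r _]; last by rewrite lee_fin ler0n.
  rewrite setI1 sE esum_set1 ?eqxx ?lee_fin// esum1 ?adde0// => r [_ /=].
  by move=> /eqP; rewrite eq_sym => /negbTE ->.
rewrite esum1// => r Er; case: eqP => // sr.
by move: sE; rewrite sr notin_setE.
Qed.

Lemma hitD s (t h : R) : 0 <= t -> 0 <= h ->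
  (hit s (t + h))%:E = \esum_(r in [set: S]) (p h s r * hit r t)%:E.
Proof.
move=> t0 h0; rewrite hitE ?addr_ge0//.
have [_ _ pD _ _] := hp.
under eq_esum => r _ do rewrite addrC -pD//.
rewrite esum_exchange => [|i j]; last by rewrite lee_fin mulr_ge0 ?p_ge0.
apply: eq_esum => r _; rewrite EFinM hitE// -esumZl ?p_ge0// => r'.
by rewrite lee_fin p_ge0.
Qed.

(** A finite set outside of which all rates from [s] vanish; duplicates are removed because
    different clocks may lead to the same state. *)
Let F s : seq S := undup (s :: [seq a i s | i : 'I_n]).

Let F_uniq s : uniq (F s). Proof. exact: undup_uniq. Qed.

Let F_self s : s \in F s. Proof. by rewrite mem_undup mem_head. Qed.

Let F_jump s i : a i s \in F s.
Proof. by rewrite mem_undup inE; apply/orP; right; exact: (codom_f (a ^~ s)). Qed.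

Let sum_pick s r (f : S -> R) : r \in F s ->
  \sum_(r' <- F s) (r == r')%:R * f r' = f r.
Proof.
move=> rF; rewrite (bigD1_seq r)//= eqxx mul1r big1 ?addr0// => r' rr'.
by rewrite eq_sym (negbTE rr') mul0r.
Qed.

Let sum_rate s (f : S -> R) :
  \sum_(r <- F s) (\sum_(i < n) ((a i s == r)%:R - (s == r)%:R)) * f r
  = \sum_(i < n) (f (a i s) - f s).
Proof.
under eq_bigr do rewrite mulr_suml.
rewrite exchange_big; apply: eq_bigr => i _.
by under eq_bigr do rewrite mulrBl; rewrite sumrB !sum_pick.
Qed.

(** The factor 2 pays once for the deviation on [F s] and once for the mass that escapes from
    [F s]. *)
Let err s (h : R) : R := 2 * \sum_(r <- F s)
  `|h^-1 * (p h s r - (s == r)%:R) - \sum_(i < n) ((a i s == r)%:R - (s == r)%:R)|.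

Let err_cvg s : err s h @[h --> 0^'+] --> 0.
Proof.
rewrite -[X in _ --> X](mulr0 2); apply: cvgM; first exact: cvg_cst.
rewrite -[X in _ --> X](@big1_eq _ 0 +%R _ (F s) xpredT).
apply: cvg_sum_seq => r.
by apply/norm_cvg0P/subr_cvg0; case: hp => _ _ _ _; exact.
Qed.

(* Chapman-Kolmogorov over the first [h] units of time; the states outside the
   finite set [F s] together carry mass at most [1 - \sum_(r <- F s) p h s r],
   which is [o(h)] because the rates out of [s] sum to zero. *)
Let hit_expand s (t h : R) : 0 <= t -> 0 < h ->
  `|hit s (t + h) - hit s t - h * \sum_(i < n) (hit (a i s) t - hit s t)|
    <= h * err s h.
Proof.
move=> t0 h0; have h0' := ltW h0.
pose d r := h^-1 * (p h s r - (s == r)%:R)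
  - \sum_(i < n) ((a i s == r)%:R - (s == r)%:R).
(* Here [p h s r] is written as the identity, plus [h] times the rate, plus [h] times the remainder
   [d r]. *)
have dE (f : S -> R) : \sum_(r <- F s) p h s r * f r
    = f s + h * \sum_(i < n) (f (a i s) - f s) + h * \sum_(r <- F s) d r * f r.
  rewrite -sum_rate -addrA -mulrDr -big_split/= -{1}(sum_pick s s f (F_self s)).
  rewrite mulr_sumr -big_split/=; apply: eq_bigr => r _.
  by rewrite /d; set q := \sum_(i < n) _; field; rewrite gt_eqF.
have dle (f : S -> R) : (forall r, 0 <= f r <= 1) ->
    `|\sum_(r <- F s) d r * f r| <= \sum_(r <- F s) `|d r|.
  move=> f01; rewrite (le_trans (ler_norm_sum _ _ _))// ler_sum// => r _.
  by have /andP[f0 f1] := f01 r; rewrite normrM ler_piMr// ger0_norm.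
have split (f : S -> R) : (forall r, 0 <= f r) ->
    \esum_(r in [set: S]) (p h s r * f r)%:E = ((\sum_(r <- F s) p h s r * f r)%:E
      + \esum_(r in ~` [set` F s]) (p h s r * f r)%:E)%E.
  move=> f0; rewrite (esumID [set` F s]) => [|r _]; last first.
    by rewrite lee_fin mulr_ge0 ?p_ge0.
  rewrite !setTI esum_fset => [||r _]; last by rewrite lee_fin mulr_ge0 ?p_ge0.
    by rewrite -fsbig_seq// sumEFin.
  exact: finite_seq.
have mass : (\esum_(r in ~` [set` F s]) (p h s r)%:E
    = (1 - \sum_(r <- F s) p h s r)%:E)%E.
  have := p_sum h s h0'; under eq_esum do rewrite -[p h s _]mulr1.
  rewrite split//; under eq_bigr do rewrite mulr1.
  under eq_esum do rewrite mulr1.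
  by move=> massE; rewrite EFinB -massE [X in (X - _)%E]addeC addeK.
have hit01 r : 0 <= hit r t <= 1 by rewrite hit_ge0 ?hit_le1.
have := hitD s t h t0 h0'; rewrite split => [|r]; last by rewrite hit_ge0.
set rest := (X in (_ + X)%E) => hitS.
have rest0 : (0 <= rest)%E.
  by rewrite esum_ge0// => r _; rewrite lee_fin mulr_ge0 ?hit_ge0 ?p_ge0.
have rest1 : (rest <= (1 - \sum_(r <- F s) p h s r)%:E)%E.
  by rewrite -mass le_esum// => r _; rewrite lee_fin ler_piMr ?hit_le1 ?p_ge0.
have lo : \sum_(r <- F s) p h s r * hit r t <= hit s (t + h).
  by rewrite -lee_fin hitS leeDl.
have hi : hit s (t + h) <=
    \sum_(r <- F s) p h s r * hit r t + (1 - \sum_(r <- F s) p h s r).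
  by rewrite -lee_fin hitS EFinD leeD2l.
(* For the constant function 1 the rate term cancels, so the escaping mass is [- h] times the sum of
   the [d r]. *)
have := dE (fun=> 1); under eq_bigr do rewrite mulr1.
rewrite [X in 1 + h * X]big1 ?mulr0 ?addr0 => [massE|i _]; last by rewrite subrr.
have le1 : - \sum_(r <- F s) d r * 1 <= \sum_(r <- F s) `|d r|.
  by rewrite (le_trans (ler_norm _))// normrN dle// => r; rewrite ler01 lexx.
have := dle _ hit01; rewrite ler_norml => /andP[dlo dhi].
have := dE (hit ^~ t).
move: lo hi massE le1 dlo dhi; rewrite /err -/d.
set A := \sum_(i < n) _; set D := \sum_(r <- F s) `|d r|.
set D1 := \sum_(r <- F s) d r * 1; set D2 := \sum_(r <- F s) d r * _.
set P1 := \sum_(r <- F s) p h s r; set P2 := \sum_(r <- F s) _ * _.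
move=> lo hi massE le1 dlo dhi P2E.
rewrite ler_norml; apply/andP; split; nra.
Qed.

(** A modulus of continuity for [hit s] that does not depend on the time: the drift is a sum of [n]
    differences of numbers in [[0, 1]]. *)
Let modulus s (h : R) : R := h * (n%:R + err s h).

Let modulus_cvg s : modulus s h @[h --> 0^'+] --> 0.
Proof.
rewrite -[X in _ --> X](mul0r (n%:R + 0)); apply: cvgM.
  by apply: cvg_at_right_filter; exact: cvg_id.
by apply: cvgD (err_cvg s); exact: cvg_cst.
Qed.

Let hit_modulus s (t h : R) : 0 <= t -> 0 < h ->
  `|hit s (t + h) - hit s t| <= modulus s h.
Proof.
move=> t0 h0; set g := \sum_(i < n) (hit (a i s) t - hit s t).
rewrite -[_ - _](subrK (h * g)) addrC (le_trans (ler_normD _ _))// /modulus.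
rewrite mulrDr lerD ?hit_expand// normrM gtr0_norm// ler_pM2l//.
rewrite (le_trans (ler_norm_sum _ _ _))//.
rewrite -[n in leRHS]card_ord -sumr_const ler_sum// => i _.
by rewrite ler_norml; have := hit_ge0 s t t0;
  have := hit_ge0 (a i s) t t0; have := hit_le1 s t t0;
  have := hit_le1 (a i s) t t0; move=> ? ? ? ?; apply/andP; split; lra.
Qed.

Lemma hit_cvg0 s : hit s t @[t --> 0^'+] --> hit s 0.
Proof.
apply/subr_cvg0/norm_cvg0P.
apply: (@squeeze_cvgr _ _ _ _ (fun=> 0) (modulus s) _ _ _ (cvg_cst _)) => //.
near=> h; rewrite normr_ge0/= -{1}[h]add0r hit_modulus//.
Unshelve. all: end_near. Qed.

(** Kolmogorov's backward equation. The transition function gives right-hand rates at time 0 only;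
    the uniform expansion and the moduli extend them to a two-sided derivative at every positive
    time. *)
Lemma hit_derive s (t : R) : 0 < t ->
  is_derive t 1 (hit s) (\sum_(i < n) (hit (a i s) t - hit s t)).
Proof.
move=> t0; apply: (@is_derive_uniform R (hit s)
  (fun u => \sum_(i < n) (hit (a i s) u - hit s u)) (err s)
  (fun h => \sum_(i < n) (modulus (a i s) h + modulus s h))) => //.
- rewrite -[X in _ --> X](@big1_eq _ 0 +%R _ (index_enum 'I_n) xpredT).
  by apply: cvg_sum_seq => i; rewrite -[X in _ --> X]addr0; exact: cvgD.
- by move=> u h u0 h0; exact: hit_expand.
move=> h h0 ht; rewrite -sumrB (le_trans (ler_norm_sum _ _ _))//.
apply: ler_sum => i _.
have th : 0 <= t - h by rewrite subr_ge0 ltW.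
have Ht s' : `|hit s' t - hit s' (t - h)| <= modulus s' h.
  by have := hit_modulus s' (t - h) h th h0; rewrite subrK.
rewrite [X in `|X|](_ : _ = (hit (a i s) t - hit (a i s) (t - h))
  - (hit s t - hit s (t - h))); last by ring.
by rewrite (le_trans (ler_normB _ _))// lerD.
Qed.

End jump_chain.

(** * The particle system *)

Lemma state_gap N (s : state N) (i j : 'I_N) : (i <= j)%N ->
  tnth (positions s) i + (j - i)%:Z <= tnth (positions s) j.
Proof.
move=> ij; case: s => -[X w] /= sX; rewrite /positions !(tnth_nth 0)/=.
move: (ltn_ord j); rewrite -(subnKC ij) addKn -[in X in (_ < X)%N](size_tuple X).
elim: (j - i)%N => [|k IH]; first by rewrite addn0 addr0.
rewrite addnS => kN; have := IH (ltnW kN).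
have : nth 0 X (i + k)%N < nth 0 X (i + k).+1 := (sortedP 0 sX) _ kN.
rewrite -lezD1 => Xk; have -> : k.+1%:Z = k%:Z + 1 by lia.
by move=> h; apply: le_trans Xk; rewrite addrA lerD2r.
Qed.

(** An exchange leaves the positions alone, and a particle moves only if no particle is at the next
    site, so it cannot meet its right neighbour. *)
Lemma attempt_sorted N (i : 'I_N) (s : state N) :
  sorted <%R (attempt i (val s)).1.
Proof.
have gap := @state_gap _ s.
case: s gap => -[X w] sX gap; rewrite /attempt /=; case: pickP => [j _|Xi].
  by case: ifP.
apply/(sortedP 0) => k; rewrite size_tuple => kN.
pose k0 := Ordinal (ltnW kN); pose k1 := Ordinal kN.
rewrite (_ : k = k0)// -tnth_nth (_ : k.+1 = k1)// -tnth_nth !tnth_mktuple.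
have := gap k0 k1 (leqnSn _); rewrite /positions/= subSnn.
have [E0|_] := eqVneq k0 i; have [E1|_] := eqVneq k1 i.
- by have := congr1 val (etrans E0 (esym E1)) => /=; lia.
- by have := Xi k1; rewrite -E0 => /eqP; lia.
- by rewrite -E1; lia.
- by lia.
Qed.

Definition attempt_state N (i : 'I_N) (s : state N) : state N :=
  State (attempt_sorted N i s).

Arguments attempt_state {N} i s.

Lemma tasep_rateE (R : realType) N : @tasep_rate R N = fun s s' =>
  \sum_(i < N) ((attempt_state i s == s')%:R - (s == s')%:R).
Proof.
by apply/funext => s; apply/funext => s'; apply: eq_bigr => i _; rewrite -val_eqE.
Qed.

(** An exchange moves a 2 to the right, so it cannot produce a word whose only 2 is at the left end.
    Once left, the word 21...1 is never regained, and leaving it amounts to being killed. *)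
Lemma word_attempt N (i : 'I_N) (s : state N) :
  word (attempt_state i s) = word21 N -> word s = word21 N.
Proof.
have gap := @state_gap _ s; case: s gap => -[X w] sX gap.
rewrite /word /= /attempt; case: pickP => // j /eqP Xj.
case: ifP => // /andP[/eqP wi /eqP wj] /= E.
have j0 : j = 0 :> nat.
  have := congr1 (fun u : N.-tuple species => tnth u j) E.
  rewrite !tnth_mktuple tpermR wi.
  by case: eqP.
have := gap j i; rewrite /positions /= j0 Xj => /(_ isT); lia.
Qed.

Section killed_prob.
Context (F : comNzRingType) (n : nat).
Implicit Types (c : int -> int -> F) (x : int) (s : state n.+1).

(** Every word other than 21...1 is a cemetery, where the value is 0. *)
Definition killed_prob c x s : F :=
  (word s == word21 n.+1)%:R * killed_det c x (tnth (positions s)).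

(** Whatever a ring does to the particles, the determinant may be evaluated as if particle [i] had
    moved freely: blocked jumps and exchanges are absorbed by the row identities. *)
Lemma killed_prob_attempt c x s i :
  (forall k m, c k (m + 1) = c k m - c (k + 1) m) -> word s = word21 n.+1 ->
  killed_prob c x (attempt_state i s)
    = killed_det c x (raise (tnth (positions s)) i).
Proof.
move=> cS; have gap := @state_gap _ s; case: s gap => -[X w] sX gap.
rewrite /killed_prob /word /positions /= /attempt => wE.
rewrite /positions /= in gap.
case: pickP => [j /eqP Xj|Xi] /=; last first.
  rewrite wE eqxx mul1r; congr killed_det; apply/funext => k.
  by rewrite tnth_mktuple.
have ji : j = i.+1 :> nat.
  have [ij|ji] := ltnP i j; last by have := gap _ _ ji; lia.
  have h : (i.+1 < n.+1)%N by apply: leq_ltn_trans (ltn_ord j).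
  have := gap (Ordinal h) j ij; have := gap i (Ordinal h) (leqnSn _) => /=.
  lia.
have w21 k : tnth w k = if val k == 0%N then sp2 else sp1.
  by rewrite wE tnth_mktuple.
(* For [i = 0] the particles exchange and the word changes, so the left side is 0; on the right,
   rows 0 and 1 coincide after the raise. For [i > 0] a second class particle is blocked. *)
have [i0|i0] := posnP i.
  rewrite !w21 /= i0 ji /=.
  rewrite (_ : _ == _ = false) ?mul0r; last first.
    apply/eqP => /(congr1 (fun u : n.+1.-tuple species => tnth u i)).
    by rewrite !tnth_mktuple tpermL w21 /= ji i0 => E; discriminate E.
  rewrite (@killed_det_collision _ _ c x _ j) ?ji ?i0//.
  have -> : i = ord0 by apply: val_inj.
  rewrite /raise eqxx Xj (_ : j == ord0 = false); last first.
    by apply/eqP => /(congr1 val); rewrite /= ji.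
  by congr (tnth _ _ + _); apply: val_inj.
have -> : (tnth w i == sp2) = false by rewrite w21 /= eqn0Ngt i0.
rewrite /= wE eqxx mul1r.
by rewrite (killed_det_blocked _ _ _ _ _ _ _ cS i0 ji).
Qed.

Lemma killed_prob_attempt_dead c x s i :
  word s <> word21 n.+1 -> killed_prob c x (attempt_state i s) = 0.
Proof.
move=> ws; rewrite /killed_prob (_ : _ == _ = false) ?mul0r//.
by apply/eqP => /word_attempt.
Qed.

End killed_prob.

Arguments killed_prob {F n} c x s.

(** * Contour integrals of continuous functions *)

Section complex_valued.
Context {R : realType}.
Implicit Types (phi psi : R -> R[i]).
Local Notation Re := complex.Re.
Local Notation Im := complex.Im.

(** Continuity is stated by components because [cintegral] integrates the real and imaginary parts
    separately. *)
Definition ccont phi : Prop :=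
  continuous (fun u => Re (phi u)) /\ continuous (fun u => Im (phi u)).

Lemma ReD (a b : R[i]) : Re (a + b) = Re a + Re b.
Proof. by case: a b => ? ? [? ?]. Qed.

Lemma ImD (a b : R[i]) : Im (a + b) = Im a + Im b.
Proof. by case: a b => ? ? [? ?]. Qed.

Lemma ReM (a b : R[i]) : Re (a * b) = Re a * Re b - Im a * Im b.
Proof. by case: a b => ? ? [? ?]. Qed.

Lemma ImM (a b : R[i]) : Im (a * b) = Re a * Im b + Im a * Re b.
Proof. by case: a b => ? ? [? ?]. Qed.

Lemma ReMr (a : R[i]) (x : R) : Re (a * x%:C) = Re a * x.
Proof. by case: a => a b; rewrite ReM /= mulr0 subr0. Qed.

Lemma eq_ReIm (a b : R[i]) : Re a = Re b -> Im a = Im b -> a = b.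
Proof. by case: a b => ? ? [? ?] /= -> ->. Qed.

Lemma ccont_cst (k : R[i]) : ccont (fun=> k).
Proof. by split=> u; exact: cvg_cst. Qed.

Lemma ccontD phi psi : ccont phi -> ccont psi -> ccont (fun u => phi u + psi u).
Proof.
move=> [pr pi] [qr qi]; split.
  by under eq_fun do rewrite ReD; move=> u; apply: cvgD; [exact: pr|exact: qr].
by under eq_fun do rewrite ImD; move=> u; apply: cvgD; [exact: pi|exact: qi].
Qed.

Lemma ccontM phi psi : ccont phi -> ccont psi -> ccont (fun u => phi u * psi u).
Proof.
move=> [pr pi] [qr qi]; split.
  under eq_fun do rewrite ReM; move=> u.
  by apply: cvgB; apply: cvgM; [exact: pr|exact: qr|exact: pi|exact: qi].
under eq_fun do rewrite ImM; move=> u.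
by apply: cvgD; apply: cvgM; [exact: pr|exact: qi|exact: pi|exact: qr].
Qed.

Lemma ccontX phi n : ccont phi -> ccont (fun u => phi u ^+ n).
Proof.
move=> cphi; elim: n => [|n IH]; first exact: ccont_cst.
by under [X in ccont X]eq_fun do rewrite exprS; exact: ccontM.
Qed.

Lemma ccontV phi : (forall u, phi u != 0) -> ccont phi ->
  ccont (fun u => (phi u)^-1).
Proof.
move=> phi0 [pr pi].
have d0 u : (Re (phi u)) ^+ 2 + (Im (phi u)) ^+ 2 != 0.
  move: (phi0 u); case: (phi u) => a b; apply: contraNneq => /= /eqP.
  by rewrite paddr_eq0 ?sqr_ge0// !sqrf_eq0 => /andP[/eqP -> /eqP ->].
have cd : continuous (fun u => ((Re (phi u)) ^+ 2 + (Im (phi u)) ^+ 2)^-1).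
  move=> u; apply: cvgV => //; under eq_fun do rewrite !expr2; rewrite !expr2.
  by apply: cvgD; apply: cvgM; (exact: pr || exact: pi).
have ReV (a : R[i]) : Re a^-1 = Re a * (Re a ^+ 2 + Im a ^+ 2)^-1 by case: a.
have ImV (a : R[i]) : Im a^-1 = - (Im a * (Re a ^+ 2 + Im a ^+ 2)^-1) by case: a.
split.
  by under eq_fun do rewrite ReV; move=> u; apply: cvgM; [exact: pr|exact: cd].
by under eq_fun do rewrite ImV; move=> u; apply: cvgN; apply: cvgM; [exact: pi|exact: cd].
Qed.

Lemma ccontXz phi (k : int) : (forall u, phi u != 0) -> ccont phi ->
  ccont (fun u => phi u ^ k).
Proof.
move=> phi0 cphi; case: k => n; first exact: ccontX.
under [X in ccont X]eq_fun do rewrite NegzE -exprnN.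
by apply: ccontV (ccontX _ _ cphi) => u; rewrite expf_neq0.
Qed.

Lemma ccont_cexp phi : ccont phi -> ccont (fun u => cexp (phi u)).
Proof.
move=> [pr pi].
have ce : continuous (fun u => expR (Re (phi u))).
  by move=> u; apply: continuous_comp; [exact: pr|exact: continuous_expR].
have ReE (a : R[i]) : Re (cexp a) = expR (Re a) * cos (Im a).
  by rewrite /cexp ReM /= mul0r subr0.
have ImE (a : R[i]) : Im (cexp a) = expR (Re a) * sin (Im a).
  by rewrite /cexp ImM /= mul0r addr0.
split.
  under eq_fun do rewrite ReE; move=> u; apply: cvgM; first exact: ce.
  by apply: continuous_comp; [exact: pi|exact: continuous_cos].
under eq_fun do rewrite ImE; move=> u; apply: cvgM; first exact: ce.
by apply: continuous_comp; [exact: pi|exact: continuous_sin].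
Qed.

Lemma continuous_integrable (f : R -> R) (a b : R) : continuous f ->
  lebesgue_measure.-integrable `[a, b] (EFin \o f).
Proof.
move=> cf; apply: continuous_compact_integrable; first exact: segment_compact.
exact: continuous_subspaceT.
Qed.

Lemma cintegralD (a b : R) phi psi : ccont phi -> ccont psi ->
  cintegral a b (fun u => phi u + psi u) = cintegral a b phi + cintegral a b psi.
Proof.
move=> [pr pi] [qr qi]; rewrite /cintegral.
under eq_Rintegral do rewrite ReD.
under [X in _ +i* X = _]eq_Rintegral do rewrite ImD.
by rewrite !RintegralD//; exact: continuous_integrable.
Qed.

Lemma cintegralZ (a b : R) (k : R[i]) phi : ccont phi ->
  cintegral a b (fun u => k * phi u) = k * cintegral a b phi.
Proof.
move=> [pr pi]; rewrite /cintegral.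
under eq_Rintegral do rewrite ReM.
under [X in _ +i* X = _]eq_Rintegral do rewrite ImM.
have ip (l : R) f : continuous f ->
    lebesgue_measure.-integrable `[a, b] (EFin \o (fun u => l * f u)).
  by move=> cf; apply: continuous_integrable => u; apply: cvgM (cf u); exact: cvg_cst.
rewrite RintegralB ?RintegralD ?RintegralZl//;
  by [apply: ip|apply: continuous_integrable|case: k].
Qed.

Lemma eq_cintegral (a b : R) phi psi :
  phi =1 psi -> cintegral a b phi = cintegral a b psi.
Proof. by move=> /funext ->. Qed.

Lemma cintegral_sum (a b : R) (I : Type) (s : seq I) (k : I -> R[i])
    (phi : I -> R -> R[i]) : (forall i, ccont (phi i)) ->
  cintegral a b (fun u => \sum_(i <- s) k i * phi i u)
    = \sum_(i <- s) k i * cintegral a b (phi i).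
Proof.
move=> cphi.
have cZ i : ccont (fun u => k i * phi i u) by apply: ccontM => //; exact: ccont_cst.
have cS l : ccont (fun u => \sum_(i <- l) k i * phi i u).
  elim: l => [|i l IH].
    by under [X in ccont X]eq_fun do rewrite big_nil; exact: ccont_cst.
  by under [X in ccont X]eq_fun do rewrite big_cons; exact: ccontD.
elim: s => [|i s IH].
  under eq_cintegral do rewrite big_nil -(mul0r (0 : R[i])).
  by rewrite cintegralZ ?mul0r ?big_nil//; exact: ccont_cst.
under eq_cintegral do rewrite big_cons.
by rewrite cintegralD// IH big_cons cintegralZ.
Qed.

End complex_valued.

(** * Circles around the origin and the contour coefficients *)

Section circle.
Context {R : realType}.
Local Notation Re := complex.Re.
Local Notation Im := complex.Im.

Definition circle (r u : R) : R[i] := r%:C * cexp ('i%C * u%:C).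

Lemma circleE r u : circle r u = (r * cos u) +i* (r * sin u).
Proof.
rewrite /circle /cexp !ReM !ImM /= !mul0r !mul1r subr0 add0r expR0.
by rewrite mul1r; apply: eq_ReIm; rewrite ?ReM ?ImM /= !mul0r ?subr0 ?addr0.
Qed.

Lemma normc_circle r u : 0 <= r -> Normc.normc (circle r u) = r.
Proof.
move=> r0; rewrite circleE /= !exprMn -mulrDr cos2Dsin2 mulr1 sqrtr_sqr.
by rewrite ger0_norm.
Qed.

Lemma circle_neq0 r u : 0 < r -> circle r u != 0.
Proof.
move=> r0; apply/negP => /eqP z0; have := normc_circle r u (ltW r0).
by rewrite z0 Normc.normc0 => /eqP; rewrite eq_sym gt_eqF.
Qed.

Lemma normc_1Bcircle r u : 0 <= r ->
  1 - r <= Normc.normc (1 - circle r u) <= 1 + r.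
Proof.
move=> r0; have N := normc_circle r u r0; apply/andP; split.
  have := le_normcD (circle r u) (1 - circle r u).
  by rewrite addrC subrK Normc.normc1 N lerBlDl.
have := le_normcD 1 (- circle r u).
by rewrite normcN Normc.normc1 N.
Qed.

Lemma circle1B_neq0 r u : 0 <= r -> r < 1 -> 1 - circle r u != 0.
Proof.
move=> r0 r1; apply/negP => /eqP z0; have /andP[+ _] := normc_1Bcircle r u r0.
by rewrite z0 Normc.normc0 subr_le0 leNgt r1.
Qed.

Lemma ccont_circle r : ccont (circle r).
Proof.
rewrite (_ : circle r = fun u => (r * cos u) +i* (r * sin u)); last first.
  by apply/funext => u; exact: circleE.
split=> u /=; (apply: cvgM; first exact: cvg_cst);
  [exact: continuous_cos|exact: continuous_sin].
Qed.

Lemma ccont_epsilon r : 0 < r -> ccont (fun u => epsilon (circle r u)).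
Proof.
move=> r0; rewrite /epsilon; apply: ccontD (ccont_cst _).
apply: ccontM (ccont_cst _) (ccontV _ _ (ccont_circle r)) => u.
exact: circle_neq0.
Qed.

Lemma circle_integralE r f : circle_integral r f =
  cintegral 0 (2 * pi) (fun u => f (circle r u) * ('i%C * circle r u)).
Proof. by []. Qed.

(** Since [dz = i z du] on the circle, one factor [z] is absorbed: the exponent is [k] instead of
    [k - 1], and no factor [i] is left. *)
Definition coef_integrand r (k m : int) (t u : R) : R[i] :=
  circle r u ^ k * (1 - circle r u) ^ m * cexp (epsilon (circle r u) * t%:C).

(* [1/(2 pi i)] times the integral over [|z| = r] of
   [z^(k-1) (1-z)^m exp(epsilon(z) t)]. *)
Definition contour_coef r (k m : int) (t : R) : R[i] :=
  (2 * pi)^-1%:C * cintegral 0 (2 * pi) (coef_integrand r k m t).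

Lemma ccont_coef r k m t : 0 < r -> r < 1 -> ccont (coef_integrand r k m t).
Proof.
move=> r0 r1; apply: ccontM; first apply: ccontM.
- by apply: ccontXz (ccont_circle r) => u; exact: circle_neq0.
- apply: ccontXz => [u|]; first by rewrite circle1B_neq0// ltW.
  have -> : (fun u => 1 - circle r u) = (fun u => 1 + (-1) * circle r u).
    by apply/funext => u; rewrite mulN1r.
  apply: ccontD; first exact: ccont_cst.
  by apply: ccontM; [exact: ccont_cst|exact: ccont_circle].
by apply/ccont_cexp/ccontM; [exact: ccont_epsilon|exact: ccont_cst].
Qed.

Lemma contour_coef_rec r k m t : 0 < r -> r < 1 ->
  contour_coef r k (m + 1) t
    = contour_coef r k m t - contour_coef r (k + 1) m t.
Proof.
move=> r0 r1; rewrite /contour_coef -mulrBr -mulN1r; congr (_ * _).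
have c1 := ccont_coef r k m t r0 r1; have c2 := ccont_coef r (k + 1) m t r0 r1.
rewrite -(cintegralZ _ _ (-1) _ c2).
rewrite -(cintegralD _ _ _ _ c1 (ccontM _ _ (ccont_cst (-1)) c2)).
apply: eq_cintegral => u; rewrite /coef_integrand !expfzDr ?circle_neq0//.
  by rewrite !expr1z; ring.
by rewrite circle1B_neq0// ltW.
Qed.

Lemma expR_rotation (u : R) (n : nat) :
  cexp ('i%C * u%:C) ^+ n = cos (n%:R * u) +i* sin (n%:R * u).
Proof.
have E (v : R) : cexp ('i%C * v%:C) = cos v +i* sin v.
  by have := circleE 1 v; rewrite /circle !mul1r.
elim: n => [|n IH]; first by rewrite expr0 mul0r cos0 sin0.
rewrite exprS IH E -natr1 mulrDl mul1r addrC cosD sinD.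
by apply: eq_ReIm; rewrite ?ReM ?ImM /=; ring.
Qed.

Lemma circleXz r u (k : int) : 0 < r ->
  circle r u ^ k = (r ^ k)%:C * (cos (k%:~R * u) +i* sin (k%:~R * u)).
Proof.
move=> r0; case: k => n.
  by rewrite -!exprnP /circle exprMn expR_rotation rmorphXn.
rewrite NegzE -!exprnN /circle exprMn expR_rotation invfM fmorphV rmorphXn.
congr (_ * _); rewrite mulrNz mulNr cosN sinN.
by apply: eq_ReIm; rewrite /= cos2Dsin2 divr1.
Qed.

Lemma cos_sin_period (k : int) :
  cos (k%:~R * (2 * pi)) = 1 :> R /\ sin (k%:~R * (2 * pi)) = 0 :> R.
Proof.
have nat_case (n : nat) :
    cos (n%:R * (2 * pi)) = 1 :> R /\ sin (n%:R * (2 * pi)) = 0 :> R.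
  have := expR_rotation (2 * pi) n; have := expR_rotation (2 * pi) 1.
  rewrite expr1 mul1r mulrDl mul1r cosDpi sinDpi cospi sinpi oppr0 opprK => ->.
  by rewrite (_ : 1 +i* 0 = 1 :> R[i])// expr1n => -[<- <-].
case: k => n; first exact: nat_case.
rewrite NegzE mulrNz mulNr cosN sinN.
by have [-> ->] := nat_case n.+1; rewrite oppr0.
Qed.

Lemma Rintegral_trig (k : int) : k != 0 ->
  Rintegral lebesgue_measure `[0, 2 * pi] (fun u : R => cos (k%:~R * u)) = 0 /\
  Rintegral lebesgue_measure `[0, 2 * pi] (fun u : R => sin (k%:~R * u)) = 0.
Proof.
move=> k0; have [c2pi s2pi] := cos_sin_period k.
have k0' : k%:~R != 0 :> R by rewrite intr_eq0.
have pi2 : 0 < 2 * pi :> R by rewrite mulr_gt0 ?pi_gt0.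
have ftc (f F : R -> R) : continuous f -> (forall u : R, is_derive u 1 F (f u)) ->
    Rintegral lebesgue_measure `[0, 2 * pi] f = F (2 * pi) - F 0.
  move=> cf dF; have cF u : {for u, continuous F}.
    by apply/differentiable_continuous/derivable1_diffP; have [] := dF u.
  rewrite /Rintegral (@continuous_FTC2 _ f F 0 (2 * pi))//.
  - exact: continuous_subspaceT.
  - split=> [u _||]; first by have [] := dF u.
      exact/cvg_at_right_filter/cF.
    exact/cvg_at_left_filter/cF.
  - by move=> u _; rewrite derive1E; have ? := dF u; rewrite derive_val.
have ck : continuous (fun u : R => k%:~R * u : R).
  by move=> u; apply: cvgM; [exact: cvg_cst|exact: cvg_id].
have dk (g : R -> R) (u l : R) : is_derive (k%:~R * u : R) 1 g l ->
    is_derive u 1 (fun u => k%:~R^-1 * g (k%:~R * u)) l.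
  move=> dg; have h := is_derive1_comp dg (is_deriveZ k%:~R (is_derive_id u 1)).
  apply: (is_derive_eq (is_deriveZ k%:~R^-1 h)).
  by rewrite /GRing.scale /= mulr1 mulrCA mulVf ?mulr1.
have dsin (u : R) := dk sin u _ (is_derive_sin _).
have dcos (u : R) := dk (- cos) u _ (is_deriveN (is_derive_cos _)).
split.
  rewrite (ftc _ _ _ dsin); first by rewrite s2pi !mulr0 sin0 mulr0 subrr.
  by move=> u; apply: continuous_comp; [exact: ck|exact: continuous_cos].
(* The antiderivative is [- cos], whose derivative comes in the form [- - sin]. *)
rewrite (_ : (fun u => sin (k%:~R * u)) = fun u => - - sin (k%:~R * u)).
  rewrite (ftc _ _ _ dcos).
    by rewrite !opprfctE c2pi mulr0 cos0 subrr.
  move=> u; apply: cvgN; apply: cvgN.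
  by apply: continuous_comp; [exact: ck|exact: continuous_sin].
by apply/funext => u; rewrite opprK.
Qed.

(** Orthogonality of the characters [exp(i k u)] on [[0, 2 pi]]. *)
Lemma contour_coef00 r k : 0 < r -> r < 1 ->
  contour_coef r k 0 0 = (k == 0)%:R.
Proof.
move=> r0 r1; rewrite /contour_coef.
have E u : coef_integrand r k 0 0 u =
    (r ^ k)%:C * (cos (k%:~R * u) +i* sin (k%:~R * u)).
  rewrite /coef_integrand expr0z mulr1 mulr0 circleXz//.
  by rewrite /cexp expR0 cos0 sin0 !mulr1.
have pi2 : 2 * pi != 0 :> R by rewrite mulf_neq0// gt_eqF// pi_gt0.
have cz : ccont (fun u => cos (k%:~R * u) +i* sin (k%:~R * u) : R[i]).
  have ck : continuous (fun u : R => k%:~R * u : R).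
    by move=> u; apply: cvgM; [exact: cvg_cst|exact: cvg_id].
  by split=> u /=; apply: continuous_comp;
    [exact: ck|exact: continuous_cos|exact: ck|exact: continuous_sin].
rewrite (eq_cintegral _ _ _ _ E) cintegralZ// /cintegral /=.
have [->|k0] := eqVneq k 0; last first.
  by have [-> ->] := Rintegral_trig k k0; rewrite (_ : 0 +i* 0 = 0 :> R[i])// !mulr0.
under eq_Rintegral do rewrite mul0r cos0.
under [X in _ +i* X]eq_Rintegral do rewrite mul0r sin0.
have L : fine (lebesgue_measure (`[0, 2 * pi]%classic : set R)) = 2 * pi.
  by rewrite lebesgue_measure_itv /= lte_fin mulr_gt0 ?pi_gt0//= subr0.
rewrite !Rintegral_cst// L mul0r mul1r expr0z mul1r.
by rewrite -rmorphM mulVf.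
Qed.

End circle.

(** * Moduli, and differentiation in time under the integral *)

Section contour_coef.
Context {R : realType}.
Local Notation Re := complex.Re.
Local Notation Im := complex.Im.
Local Notation normc := Normc.normc.

Lemma Re_le_normc (a : R[i]) : `|Re a| <= normc a.
Proof.
by case: a => a b /=; rewrite -sqrtr_sqr ler_wsqrtr// lerDl sqr_ge0.
Qed.

Lemma Im_le_normc (a : R[i]) : `|Im a| <= normc a.
Proof.
by case: a => a b /=; rewrite -sqrtr_sqr ler_wsqrtr// lerDr sqr_ge0.
Qed.

Lemma normc_cexp (a : R[i]) : normc (cexp a) = expR (Re a).
Proof.
rewrite /cexp Normc.normcM /= expr0n addr0 cos2Dsin2 sqrtr1 mulr1 sqrtr_sqr.
by rewrite ger0_norm ?expR_ge0.
Qed.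

Lemma normcX (a : R[i]) n : normc (a ^+ n) = normc a ^+ n.
Proof.
by elim: n => [|n IH]; rewrite ?Normc.normc1// !exprS Normc.normcM IH.
Qed.

Lemma normcXz (a : R[i]) (k : int) : normc (a ^ k) = normc a ^ k.
Proof.
by case: k => n; rewrite ?NegzE -?exprnN ?Normc.normcV -?exprnP normcX.
Qed.

Lemma normc_ge0 (a : R[i]) : 0 <= normc a.
Proof. by case: a => a b; exact: sqrtr_ge0. Qed.

Lemma ccont_normc (phi : R -> R[i]) : ccont phi ->
  continuous (fun u => normc (phi u)).
Proof.
move=> [pr pi].
have E (a : R[i]) : normc a = Num.sqrt (Re a * Re a + Im a * Im a).
  by case: a => a b; rewrite /= !expr2.
under eq_fun do rewrite E; move=> u.
apply: (continuous_comp (f := fun u => _ : R)); last exact: sqrt_continuous.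
by apply: cvgD; apply: cvgM; (exact: pr || exact: pi).
Qed.

Lemma is_derive_Re_cexp (a b : R[i]) (t : R) :
  is_derive t 1 (fun s : R => Re (a * cexp (b * s%:C)))
    (Re (a * b * cexp (b * t%:C))).
Proof.
have E (c : R[i]) (s : R) : Re (c * cexp (b * s%:C)) =
    expR (Re b * s) * (Re c * cos (Im b * s) - Im c * sin (Im b * s)).
  by rewrite ReM /cexp !ReM !ImM /= !mulr0 !mul0r ?add0r ?addr0 ?subr0; ring.
rewrite E; under eq_fun do rewrite E.
have dl (l : R) : is_derive t 1 (fun s => l * s : R) l.
  apply: (is_derive_eq (is_deriveZ l (is_derive_id t 1))).
  by rewrite /GRing.scale /= mulr1.
have de := is_derive1_comp (is_derive_expR _) (dl (Re b)).
have dc := is_derive1_comp (is_derive_cos _) (dl (Im b)).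
have ds := is_derive1_comp (is_derive_sin _) (dl (Im b)).
have dB : is_derive t 1 (fun s => Re a * cos (Im b * s) - Im a * sin (Im b * s))
    (Re a * (- sin (Im b * t) * Im b) - Im a * (cos (Im b * t) * Im b)).
  exact: is_deriveB (is_deriveZ (Re a) dc) (is_deriveZ (Im a) ds).
apply: (is_derive_eq (is_deriveM de dB)).
rewrite /GRing.scale /= ReM ImM.
by ring.
Qed.

Lemma is_derive_cexp_integral (x y : R) (phi w : R -> R[i]) (t : R) :
  ccont phi -> ccont w ->
  is_derive t 1 (fun s : R => Rintegral lebesgue_measure `[x, y]
      (fun u => Re (phi u * cexp (w u * s%:C))))
    (Rintegral lebesgue_measure `[x, y]
      (fun u => Re (phi u * w u * cexp (w u * t%:C)))).
Proof.
move=> cphi cw; apply: is_derive_dnbhs.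
pose f (s u : R) := Re (phi u * cexp (w u * s%:C)).
(* A dominating function for the derivative in [s], valid while [s] is within distance 1 of [t]. *)
pose G u := normc (phi u) * normc (w u) * expR (normc (w u) * (`|t| + 1)).
have cs (s : R) : ccont (fun u => cexp (w u * s%:C)).
  by apply/ccont_cexp/ccontM => //; exact: ccont_cst.
have cG : continuous G.
  move=> u; apply: cvgM; first by apply: cvgM; exact: ccont_normc.
  apply: (continuous_comp (f := fun u => _ : R)); last exact: continuous_expR.
  by apply: cvgM; [exact: ccont_normc|exact: cvg_cst].
have df (s u : R) : partial1of2 f s u = Re (phi u * w u * cexp (w u * s%:C)).
  have ? := is_derive_Re_cexp (phi u) (w u) s.
  by rewrite partial1of2E; exact: derive_val.
have := @cvg_differentiation_under_integral R _ _ lebesgue_measure f `[x, y]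
  (measurable_itv _) t (t - 1) (t + 1).
move=> /(_ _ _ _ G _ _ _).
under [X in _ --> X]eq_Rintegral do rewrite df.
apply.
- by rewrite /= in_itv/= ltrBlDr !ltrDl ltr01.
- by move=> s _; apply: continuous_integrable; have [] := ccontM _ _ cphi (cs s).
- by move=> s u _ _; have [] := is_derive_Re_cexp (phi u) (w u) s.
- by move=> u; rewrite !mulr_ge0 ?normc_ge0 ?expR_ge0.
- exact: continuous_integrable.
move=> s u; rewrite /= in_itv/= => /andP[ts st] _; rewrite df.
rewrite (le_trans (Re_le_normc _))// (Normc.normcM (phi u * w u)).
rewrite (Normc.normcM (phi u)) normc_cexp.
rewrite ler_wpM2l ?mulr_ge0 ?normc_ge0// ler_expR ReMr.
rewrite (le_trans (ler_norm _))// normrM ler_pM ?Re_le_normc//.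
have := ler_norm t; have := ler_norm (- t); rewrite normrN => ? ?.
by rewrite ler_norml; apply/andP; split; lra.
Qed.

End contour_coef.

(** * Bounds, time evolution and initial values of the coefficients *)

Section real_coef.
Context {R : realType} (r : R) (r_gt0 : 0 < r) (r_lt1 : r < 1).
Local Notation Re := complex.Re.
Local Notation Im := complex.Im.
Local Notation normc := Normc.normc.

Let r_ge0 : 0 <= r. Proof. exact: ltW. Qed.

(** On the circle [2 / (1 - r)] bounds both [|1 - z|] and its inverse, so either sign of [m] is
    covered; the real part of [epsilon z] is at most [r^-1]. *)
Let bound (k m : int) (t : R) : R :=
  r ^ k * (2 / (1 - r)) ^+ `|m|%N * expR (r^-1 * t).

Let normc_integrand (k m : int) (t u : R) : 0 <= t ->
  normc (coef_integrand r k m t u) <= bound k m t.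
Proof.
move=> t0; rewrite /coef_integrand (Normc.normcM (_ * _)) (Normc.normcM (_ ^ k)).
rewrite !normcXz normc_cexp normc_circle//.
have r1 : 0 < 1 - r by rewrite subr_gt0.
have L0 : 0 <= 2 / (1 - r) by rewrite divr_ge0// ltW.
rewrite ler_pM ?mulr_ge0 ?exprz_ge0 ?normc_ge0 ?expR_ge0//.
  rewrite ler_wpM2l ?exprz_ge0//.
  have /andP[lo hi] := normc_1Bcircle r u r_ge0.
  have n0 : 0 < normc (1 - circle r u) by rewrite (lt_le_trans r1).
  have L2 : normc (1 - circle r u) <= 2 / (1 - r).
    rewrite (le_trans hi)// ler_pdivlMr//; nra.
  have LV : (normc (1 - circle r u))^-1 <= 2 / (1 - r).
    rewrite -[leLHS]mul1r ler_pM ?invr_ge0 ?normc_ge0// ?ler1n//.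
    by rewrite lef_pV2.
  case: m => n; rewrite ?NegzE -?exprnN -?exprnP -?exprVn;
    by rewrite lerXn2r ?nnegrE ?invr_ge0 ?normc_ge0.
rewrite ler_expR ReMr ler_wpM2r// /epsilon ReD mul1r.
rewrite (_ : Re (-1) = -1)// (le_trans (_ : _ <= Re (circle r u)^-1))//.
  by rewrite gerDl oppr_le0 ler01.
rewrite (le_trans (ler_norm _))// (le_trans (Re_le_normc _))//.
by rewrite Normc.normcV normc_circle.
Qed.

Let Rintegral_le (f : R -> R) (B : R) : continuous f -> (forall u, `|f u| <= B) ->
  `|(2 * pi)^-1 * Rintegral lebesgue_measure `[0, 2 * pi] f| <= B.
Proof.
move=> cf fB.
have pi2 : 0 < 2 * pi :> R by rewrite mulr_gt0 ?pi_gt0.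
have L : fine (lebesgue_measure (`[0, 2 * pi]%classic : set R)) = 2 * pi.
  by rewrite lebesgue_measure_itv /= lte_fin pi2 /= subr0.
rewrite normrM gtr0_norm ?invr_gt0// ler_pdivrMl//.
rewrite (_ : 2 * pi * B = Rintegral lebesgue_measure `[0, 2 * pi] (fun=> B));
  last by rewrite Rintegral_cst// L mulrC.
rewrite (le_trans (le_normr_Rintegral _ _))//.
  exact: continuous_integrable.
apply: le_Rintegral => //; apply: continuous_integrable => u; last exact: cvg_cst.
by apply: (continuous_comp (f := f)); [exact: cf|exact: norm_continuous].
Qed.

Lemma Re_contour_coef k m t : Re (contour_coef r k m t) =
  (2 * pi)^-1 * Rintegral lebesgue_measure `[0, 2 * pi]
    (fun u => Re (coef_integrand r k m t u)).
Proof. by rewrite /contour_coef ReM /= mul0r subr0. Qed.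

Lemma Im_contour_coef k m t : Im (contour_coef r k m t) =
  (2 * pi)^-1 * Rintegral lebesgue_measure `[0, 2 * pi]
    (fun u => Im (coef_integrand r k m t u)).
Proof. by rewrite /contour_coef ImM /= mul0r addr0. Qed.

Lemma Re_contour_coef_le k m t : 0 <= t ->
  `|Re (contour_coef r k m t)| <= bound k m t.
Proof.
move=> t0; rewrite Re_contour_coef; apply: Rintegral_le.
  by have [] := ccont_coef r k m t r_gt0 r_lt1.
by move=> u; rewrite (le_trans (Re_le_normc _))// normc_integrand.
Qed.

Lemma Im_contour_coef_le k m t : 0 <= t ->
  `|Im (contour_coef r k m t)| <= bound k m t.
Proof.
move=> t0; rewrite Im_contour_coef; apply: Rintegral_le.
  by have [] := ccont_coef r k m t r_gt0 r_lt1.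
by move=> u; rewrite (le_trans (Im_le_normc _))// normc_integrand.
Qed.

(** The time derivative brings down [epsilon z], and [epsilon z * z ^ k = z ^ (k - 1) - z ^ k]. *)
Let integrand_shift k m t u :
  circle r u ^ k * (1 - circle r u) ^ m * epsilon (circle r u)
    * cexp (epsilon (circle r u) * t%:C)
  = coef_integrand r (k - 1) m t u - coef_integrand r k m t u.
Proof.
rewrite /coef_integrand /epsilon expfzDr ?circle_neq0//.
by rewrite -exprnN expr1 mul1r; ring.
Qed.

Let ccont_kernel k m : ccont (fun u => circle r u ^ k * (1 - circle r u) ^ m).
Proof.
have -> : (fun u => circle r u ^ k * (1 - circle r u) ^ m) = coef_integrand r k m 0.
  by apply/funext => u; rewrite /coef_integrand mulr0 /cexp expR0 cos0 sin0 !mulr1.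
exact: ccont_coef.
Qed.

Lemma is_derive_Re_contour_coef k m (t : R) :
  is_derive t 1 (fun t => Re (contour_coef r k m t))
    (Re (contour_coef r (k - 1) m t) - Re (contour_coef r k m t)).
Proof.
under eq_fun do rewrite Re_contour_coef.
rewrite !Re_contour_coef -mulrBr -RintegralB//; last first.
- by apply: continuous_integrable; have [] := ccont_coef r k m t r_gt0 r_lt1.
- by apply: continuous_integrable; have [] := ccont_coef r (k - 1) m t r_gt0 r_lt1.
apply: is_deriveZ.
have := is_derive_cexp_integral 0 (2 * pi) _ _ t
  (ccont_kernel k m) (ccont_epsilon r r_gt0).
move=> h; apply: (is_derive_eq h); apply: eq_Rintegral => u _.
by rewrite integrand_shift ReD; case: (coef_integrand r k m t u).
Qed.

Lemma is_derive_Im_contour_coef k m (t : R) :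
  is_derive t 1 (fun t => Im (contour_coef r k m t))
    (Im (contour_coef r (k - 1) m t) - Im (contour_coef r k m t)).
Proof.
(* Multiplying by [- i] reduces the claim to the derivative of a real part. *)
have ImRe (a : R[i]) : Im a = Re (- 'i%C * a) by case: a => a b; simpc.
have ck : ccont (fun u => - 'i%C * (circle r u ^ k * (1 - circle r u) ^ m)).
  by apply: ccontM; [exact: ccont_cst|exact: ccont_kernel].
under eq_fun do rewrite Im_contour_coef.
rewrite !Im_contour_coef -mulrBr -RintegralB//; last first.
- by apply: continuous_integrable; have [] := ccont_coef r k m t r_gt0 r_lt1.
- by apply: continuous_integrable; have [] := ccont_coef r (k - 1) m t r_gt0 r_lt1.
apply: is_deriveZ.
have := is_derive_cexp_integral 0 (2 * pi) _ _ t ck (ccont_epsilon r r_gt0).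
under eq_fun => s do under eq_Rintegral => u _ do rewrite -mulrA -ImRe.
move=> h; apply: (is_derive_eq h); apply: eq_Rintegral => u _.
rewrite -!(mulrA (- 'i%C)) -ImRe integrand_shift ImD.
by case: (coef_integrand r k m t u).
Qed.

Let constant_vanish (f : nat -> R) (B : R) :
  (forall j, f j = f j.+1) -> (forall j, `|f j| <= B * r ^+ j) -> f 0%N = 0.
Proof.
move=> fc fB; apply/eqP; rewrite -normr_le0.
have f0 j : f j = f 0%N by elim: j => // j <-.
have lim : B * r ^+ j @[j --> \oo] --> B * 0.
  by apply: cvgM; [exact: cvg_cst|apply: cvg_expr; rewrite gtr0_norm].
rewrite mulr0 in lim; rewrite -(cvg_lim _ lim)//; apply: limr_ge.
  by apply/cvg_ex; eexists; exact: lim.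
by near=> j; rewrite -(f0 j).
Unshelve. all: end_near. Qed.

(* The recursion propagates [f k m = 0] to [m - 1] by making [f k (m - 1)]
   constant in [k], hence zero by decay; this replaces the expansion of
   [(1 - z) ^ m] for negative [m]. *)
Let recursion_vanish (f : int -> int -> R) (B : int -> R) (k0 : int) :
  (forall k m, f k (m + 1) = f k m - f (k + 1) m) ->
  (forall k m, `|f k m| <= r ^ k * B m) ->
  (forall k, k0 < k -> f k 0 = 0) -> forall k m, m <= 0 -> k0 < k -> f k m = 0.
Proof.
move=> fS fB f0 k m m0 k0k; have -> : m = - `|m|%N%:Z by lia.
elim: (`|m|%N) k k0k => [|n IH] k k0k; first by rewrite oppr0 f0.
rewrite -[k]addr0.
apply: (@constant_vanish (fun j => f (k + j%:Z) (- n.+1%:Z)) (r ^ k * B (- n.+1%:Z))).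
  move=> j; apply/eqP; rewrite -subr_eq0; apply/eqP.
  have -> : k + j.+1%:Z = k + j%:Z + 1 by lia.
  rewrite -fS (_ : - n.+1%:Z + 1 = - n%:Z); last by lia.
  by apply: IH; lia.
move=> j; rewrite (le_trans (fB _ _))// expfzDr ?gt_eqF//.
by rewrite -exprnP mulrAC.
Qed.

Let bound0 k m : bound k m 0 = r ^ k * (2 / (1 - r)) ^+ `|m|%N.
Proof. by rewrite /bound mulr0 expR0 mulr1. Qed.

(** Brings the bound to the form [A * K ^+ wt] of the uniqueness lemma, with [K = r^-1] and weight
    [|k|]. *)
Let boundK k m (t T : R) : 0 <= t -> t <= T -> bound k m t <=
  (2 / (1 - r)) ^+ `|m|%N * expR (r^-1 * T) * r^-1 ^+ `|k|%N.
Proof.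
move=> t0 tT; rewrite /bound -mulrA mulrC.
have L0 : 0 <= 2 / (1 - r) by rewrite divr_ge0// subr_ge0 ltW.
rewrite ler_pM ?mulr_ge0 ?exprn_ge0 ?exprz_ge0 ?expR_ge0//.
  by rewrite ler_wpM2l ?exprn_ge0// ler_expR ler_wpM2l// invr_ge0.
case: k => k; rewrite ?NegzE -?exprnN -?exprnP /= exprVn//.
have rk := exprn_gt0 k r_gt0.
have rk1 : r ^+ k <= 1 by rewrite exprn_ile1// ltW.
by rewrite (le_trans rk1)// invf_ge1.
Qed.

Let Im_rec k m t : Im (contour_coef r k (m + 1) t) =
  Im (contour_coef r k m t) - Im (contour_coef r (k + 1) m t).
Proof.
by rewrite contour_coef_rec// ImD; case: (contour_coef r (k + 1) m t).
Qed.

Let Im_initial k m : Im (contour_coef r k m 0) = 0.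
Proof.
have Im00 k' : Im (contour_coef r k' 0 0) = 0.
  by rewrite contour_coef00//; case: eqP.
have [m0|m0] := leP m 0.
  (* At [m = 0] the imaginary part vanishes for all [k], so any threshold is allowed; [k - 1] is one
     that includes [k]. *)
  apply: (@recursion_vanish (fun k m => Im (contour_coef r k m 0))
    (fun m => (2 / (1 - r)) ^+ `|m|%N) (k - 1)) => //.
  - by move=> k' m'; rewrite -bound0 Im_contour_coef_le.
  - by lia.
have -> : m = `|m|%N by lia.
elim: (`|m|%N) k => [|n IH] k; first exact: Im00.
by have -> : n.+1%:Z = n%:Z + 1 by [lia]; rewrite Im_rec !IH subrr.
Qed.

(* The imaginary part solves the jump equation of a single free particle with
   zero initial value. *)
Lemma contour_coef_real k m (t : R) : 0 <= t ->
  contour_coef r k m t = (Re (contour_coef r k m t))%:C.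
Proof.
move=> t0; apply: eq_ReIm => //=.
have dIm k' := is_derive_Im_contour_coef k' m.
have cIm k' : {for 0, continuous (fun t => Im (contour_coef r k' m t))}.
  by apply/differentiable_continuous/derivable1_diffP; have [] := dIm k' 0.
apply: (@jump_equation_unique R int 1 (fun _ k => k - 1) absz
  (fun k t => Im (contour_coef r k m t)) t
  ((2 / (1 - r)) ^+ `|m|%N * expR (r^-1 * t)) r^-1) => //.
- by move=> _ k'; lia.
- by rewrite mulr_ge0 ?expR_ge0// exprn_ge0// divr_ge0// subr_ge0 ltW.
- by rewrite invf_ge1// ltW.
- by move=> k'; exact/cvg_at_right_filter/cIm.
- by move=> k' s s0; rewrite big_ord1; exact: dIm.
- by move=> k' s s0 st; rewrite (le_trans (Im_contour_coef_le _ _ _ _))// boundK.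
Qed.

(** The hitting probabilities are real, so the comparison uses real coefficients; by
    [contour_coef_real] nothing is lost for [0 <= t]. *)
Definition rcoef (k m : int) (t : R) : R := Re (contour_coef r k m t).

Lemma rcoef_rec k m t : rcoef k (m + 1) t = rcoef k m t - rcoef (k + 1) m t.
Proof.
by rewrite /rcoef contour_coef_rec// ReD; case: (contour_coef r (k + 1) m t).
Qed.

Lemma rcoef_le k m (t T : R) : 0 <= t -> t <= T -> `|rcoef k m t| <=
  (2 / (1 - r)) ^+ `|m|%N * expR (r^-1 * T) * r^-1 ^+ `|k|%N.
Proof. by move=> t0 tT; rewrite (le_trans (Re_contour_coef_le _ _ _ _))// boundK. Qed.

Lemma rcoef00 k : rcoef k 0 0 = (k == 0)%:R.
Proof. by rewrite /rcoef contour_coef00//; case: eqP. Qed.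

Lemma rcoef0_lt k (m : nat) : k < - m%:Z -> rcoef k m%:Z 0 = 0.
Proof.
elim: m k => [|m IH] k km.
  by rewrite rcoef00; case: eqP => // k0; lia.
by have -> : m.+1%:Z = m%:Z + 1 by [lia]; rewrite rcoef_rec !IH ?subrr//; lia.
Qed.

(** For [k > 0] the integrand [z ^ (k - 1) (1 - z) ^ m] has no pole in the disc. The value 0 at
    [m = 0] is propagated by the recursion, downwards with the help of decay in [k]. *)
Lemma rcoef0_gt0 k m : 0 < k -> rcoef k m 0 = 0.
Proof.
move=> k0; have [m0|m0] := leP m 0.
  apply: (@recursion_vanish (fun k m => rcoef k m 0)
    (fun m => (2 / (1 - r)) ^+ `|m|%N) 0) => //.
  - by move=> k' m'; exact: rcoef_rec.
  - by move=> k' m'; rewrite -bound0 Re_contour_coef_le.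
  - by move=> k' k'0; rewrite rcoef00 gt_eqF.
have -> : m = `|m|%N by lia.
elim: (`|m|%N) k k0 => [|n IH] k k0; first by rewrite rcoef00 gt_eqF.
have -> : n.+1%:Z = n%:Z + 1 by lia.
by rewrite rcoef_rec !IH ?subrr//; lia.
Qed.

(** These are the coefficients of the geometric series [1 / (1 - z)], obtained by unrolling the
    recursion from [k = 0] downwards. *)
Lemma rcoef0_N1 k : k <= 0 -> rcoef k (- 1) 0 = 1.
Proof.
move=> k0; have -> : k = - `|k|%N%:Z by lia.
have E k' : rcoef k' (- 1) 0 = rcoef k' 0 0 + rcoef (k' + 1) (- 1) 0.
  by have := rcoef_rec k' (- 1) 0; rewrite addNr => ->; rewrite subrK.
elim: (`|k|%N) => [|n IH]; first by rewrite E rcoef00 rcoef0_gt0// eqxx addr0.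
rewrite E rcoef00 (_ : - n.+1%:Z + 1 = - n%:Z); last by lia.
by rewrite IH add0r.
Qed.

End real_coef.

(** * The hitting probability as a determinant *)

Lemma is_derive_prod (R : realType) n (f : 'I_n -> R -> R) (f' : 'I_n -> R) (t : R) :
  (forall i, is_derive t 1 (f i) (f' i)) ->
  is_derive t 1 (fun s => \prod_(i < n) f i s)
    (\sum_(i < n) \prod_(j < n) if j == i then f' j else f j t).
Proof.
elim: n f f' => [|n IH] f f' df.
  by under eq_fun do rewrite big_ord0; rewrite big_ord0; exact: is_derive_cst.
under eq_fun do rewrite big_ord_recl.
have d0 := df ord0.
have dP := IH (fun i => f (lift ord0 i)) (fun i => f' (lift ord0 i))
  (fun i => df (lift ord0 i)).
apply: (is_derive_eq (is_deriveM d0 dP)).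
rewrite big_ord_recl /= addrC /GRing.scale /=; congr (_ + _).
  rewrite big_ord_recl eqxx mulrC; congr (_ * _).
by rewrite mulr_sumr; apply: eq_bigr => i _; rewrite big_ord_recl.
Qed.

Lemma is_derive_bigsum (R : realType) (I : Type) (s : seq I) (f : I -> R -> R)
    (f' : I -> R) (t : R) : (forall i, is_derive t 1 (f i) (f' i)) ->
  is_derive t 1 (fun u => \sum_(i <- s) f i u) (\sum_(i <- s) f' i).
Proof.
move=> df; elim: s => [|i s IH].
  by under eq_fun do rewrite big_nil; rewrite big_nil; exact: is_derive_cst.
under eq_fun do rewrite big_cons; rewrite big_cons.
by have ? := df i; exact: is_deriveD.
Qed.

Lemma is_derive_det (R : realType) n (M : R -> 'M[R]_n) (M' : 'M[R]_n) (t : R) :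
  (forall i j, is_derive t 1 (fun s => M s i j) (M' i j)) ->
  is_derive t 1 (fun s => \det (M s))
    (\sum_(i < n) \det (\matrix_(k, l) if k == i then M' k l else M t k l)).
Proof.
move=> dM; rewrite /determinant.
have dterm (s : 'S_n) := is_deriveZ ((-1) ^+ s)
  (is_derive_prod _ _ _ _ t (fun i => dM i (s i))).
apply: (is_derive_eq (is_derive_bigsum _ _ _ _ _ t dterm)).
rewrite exchange_big /=; apply: eq_bigr => s _.
rewrite /GRing.scale /= mulr_sumr; apply: eq_bigr => i _; congr (_ * _).
by apply: eq_bigr => j _; rewrite mxE.
Qed.

Lemma ler_norm_det (R : realType) n (M : 'M[R]_n) (b : 'I_n -> R) :
  (forall i j, `|M i j| <= b i) -> `|\det M| <= n`!%:R * \prod_(i < n) b i.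
Proof.
move=> Mb; rewrite (le_trans (ler_norm_sum _ _ _))//.
rewrite mulr_natl -card_Sn -sumr_const; apply: ler_sum => s _.
rewrite normrM normr_sign mul1r normr_prod ler_prod// => i _.
by rewrite normr_ge0 Mb.
Qed.

(** The weight for the uniqueness lemma: a ring raises it by at most one, and the determinant grows
    at most like [r^-1] to this power. *)
Definition weight N (s : state N) : nat :=
  (\sum_(i < N) `|tnth (positions s) i|)%N.

Lemma weight_attempt N (i : 'I_N) (s : state N) :
  (weight _ (attempt_state i s) <= (weight _ s).+1)%N.
Proof.
rewrite /weight /positions /=; case: s => -[X w] sX /=; rewrite /attempt.
case: pickP => [j _|_]; first by case: ifP.
rewrite (bigD1 i)//= [in leqRHS](bigD1 i)//= tnth_mktuple eqxx -addSn.
apply: leq_add; first by lia.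
by apply: eq_leq; apply: eq_bigr => k /negbTE ki; rewrite tnth_mktuple ki.
Qed.

Section hitting.
Context {R : realType} (r : R) (r_gt0 : 0 < r) (r_lt1 : r < 1) (n : nat).
Context (p : R -> state n.+1 -> state n.+1 -> R).
Hypothesis hp : transition_function (@tasep_rate R n.+1) p.
Implicit Types (x : int) (s : state n.+1).

Definition target x : set (state n.+1) :=
  [set s | word s = word21 n.+1 /\ nth 0 (positions s) 0 = x].

Let V x s (t : R) : R := killed_prob (fun k m => rcoef r k m t) x s.

(** Differentiating row [i] replaces its entries [c k] by [c (k - 1) - c k], which is the effect of
    raising [y i] minus the original row. The determinant thus evolves as for free particles. *)
Lemma is_derive_killed_det x (y : 'I_n.+1 -> int) (t : R) :
  is_derive t 1 (fun t => killed_det (fun k m => rcoef r k m t) x y)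
    (\sum_(i < n.+1) (killed_det (fun k m => rcoef r k m t) x (raise y i)
      - killed_det (fun k m => rcoef r k m t) x y)).
Proof.
pose M (t : R) : 'M[R]_n.+1 :=
  \matrix_(i, j) rcoef r (x - y i + j%:Z) (i.-1%:Z - j%:Z) t.
pose M' : 'M[R]_n.+1 := \matrix_(i, j)
  (rcoef r (x - y i + j%:Z - 1) (i.-1%:Z - j%:Z) t - M t i j).
have dM i j : is_derive t 1 (fun u => M u i j) (M' i j).
  under eq_fun do rewrite mxE; rewrite !mxE.
  exact: is_derive_Re_contour_coef.
apply: (is_derive_eq (is_derive_det _ _ _ _ t dM)); apply: eq_bigr => i _.
apply/eqP; rewrite eq_sym subr_eq; apply/eqP.
rewrite /killed_det (@determinant_multilinear _ _ _
  (\matrix_(k, l) if k == i then M' k l else M t k l) (M t) i 1 1).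
- by rewrite !mul1r.
- apply/rowP => j; rewrite !mxE eqxx /raise eqxx !mul1r subrK.
  by rewrite (_ : x - (y i + 1) + j%:Z = x - y i + j%:Z - 1)//; lia.
- by apply/matrixP => k l; rewrite !mxE /raise eq_sym (negbTE (neq_lift _ _)).
- by apply/matrixP => k l; rewrite !mxE /raise eq_sym (negbTE (neq_lift _ _)).
Qed.

Let V_derive x s (t : R) :
  is_derive t 1 (V x s) (\sum_(i < n.+1) (V x (attempt_state i s) t - V x s t)).
Proof.
have rec k m := rcoef_rec r r_gt0 r_lt1 k m t.
have [ws|ws] := eqVneq (word s) (word21 n.+1).
  have VE u : V x s u = killed_det (fun k m => rcoef r k m u) x (tnth (positions s)).
    by rewrite /V /killed_prob ws eqxx mul1r.
  under eq_bigr do rewrite /V (killed_prob_attempt _ _ _ _ _ _ rec ws) -/(V x s t) VE.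
  by rewrite (funext VE); exact: is_derive_killed_det.
have V0 u : V x s u = 0 by rewrite /V /killed_prob (negbTE ws) mul0r.
rewrite (funext V0) big1 => [|i _]; first exact: is_derive_cst.
by rewrite subr0 /V killed_prob_attempt_dead//; apply/eqP.
Qed.

Let V_initial x s : V x s 0 = (s \in target x)%:R.
Proof.
rewrite /V /killed_prob killed_det_initial.
- rewrite -natrM mulnb; congr (nat_of_bool _)%:R; apply/idP/idP.
    by move=> /andP[/eqP ws /eqP yx]; rewrite inE; split; rewrite // -yx (tnth_nth 0).
  by rewrite inE => -[-> <-]; rewrite eqxx/= (tnth_nth 0).
- exact: rcoef00.
- by move=> k m; exact: rcoef0_gt0.
- exact: rcoef0_N1.
- by move=> k m; exact: rcoef0_lt.
by move=> i; have := state_gap _ s ord0 i isT; rewrite subn0.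
Qed.

Let V_bound x (T : R) : exists2 A, 0 <= A &
  forall s t, 0 <= t -> t <= T -> `|V x s t| <= A * r^-1 ^+ weight _ s.
Proof.
pose L := 2 / (1 - r).
have L1 : 1 <= L.
  rewrite /L ler_pdivlMr ?subr_gt0// mul1r.
  by rewrite (@le_trans _ _ 1)// ?ler1n// gerDl oppr_le0 ltW.
have K1 : 1 <= r^-1 by rewrite invf_ge1// ltW.
(* In entry [(i, j)] the power of [1 - z] is at most [n] in absolute value, and that of [z] at most
   [|x| + n + |y i|]. *)
pose B := L ^+ n * expR (r^-1 * T) * r^-1 ^+ (`|x| + n)%N.
have B0 : 0 <= B.
  by rewrite !mulr_ge0 ?expR_ge0 ?exprn_ge0// ?invr_ge0 ?ltW// (lt_le_trans ltr01).
exists ((n.+1)`!%:R * B ^+ n.+1) => [|s t t0 tT].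
  by rewrite mulr_ge0 ?exprn_ge0.
apply: (@le_trans _ _ `|killed_det (fun k m => rcoef r k m t) x (tnth (positions s))|).
  rewrite /V /killed_prob normrM normr_nat; case: eqP => _.
    by rewrite mul1r.
  by rewrite mul0r.
apply: (le_trans (ler_norm_det _ _ _ (fun i => B * r^-1 ^+ `|tnth (positions s) i|%N) _)).
  move=> i j; rewrite mxE (le_trans (rcoef_le r r_gt0 r_lt1 _ _ t T t0 tT))//.
  rewrite /B -[leRHS]mulrA -exprD -/L ler_pM//.
  - by rewrite mulr_ge0 ?exprn_ge0 ?expR_ge0// (le_trans ler01).
  - by rewrite exprn_ge0// (le_trans ler01).
  - rewrite ler_wpM2r ?expR_ge0// ler_weXn2l//.
    by have := ltn_ord i; have := ltn_ord j; lia.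
  - rewrite ler_weXn2l//.
    by have := ltn_ord j; lia.
rewrite big_split /= prodr_const card_ord -mulrA.
by rewrite /weight expr_sum.
Qed.

Lemma hit_killed_prob x s (t : R) : 0 <= t ->
  hit R _ p (target x) s t = killed_prob (fun k m => rcoef r k m t) x s.
Proof.
move=> t0; have hp' := hp; rewrite tasep_rateE in hp'.
have [A A0 VA] := V_bound x t.
have K1 : 1 <= r^-1 by rewrite invf_ge1// ltW.
apply/eqP; rewrite -subr_eq0; apply/eqP.
(* In the constant [1 + A], the 1 bounds the probability and [A] the determinant. *)
apply: (@jump_equation_unique R (state n.+1) n.+1 (@attempt_state n.+1)
  (weight n.+1) (fun s t => hit R _ p (target x) s t - V x s t) t (1 + A) r^-1) => //.
- by move=> i s'; exact: weight_attempt.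
- by rewrite addr_ge0.
- by move=> s'; rewrite V_initial (hit0 _ _ _ _ _ _ hp') subrr.
- move=> s'; apply: cvgB; first exact: (hit_cvg0 _ _ _ _ _ _ hp').
  apply/cvg_at_right_filter/differentiable_continuous/derivable1_diffP.
  by have [] := V_derive x s' 0.
- move=> s' u u0; have dh := hit_derive _ _ _ _ _ (target x) hp' s' u u0.
  apply: (is_derive_eq (is_deriveB dh (V_derive x s' u))).
  by rewrite -sumrB; apply: eq_bigr => i _; ring.
move=> s' u u0 ut; rewrite (le_trans (ler_normB _ _))// mulrDl lerD ?VA//.
rewrite ger0_norm ?(hit_ge0 _ _ _ _ _ _ hp')// mul1r.
by rewrite (le_trans (hit_le1 _ _ _ _ _ _ hp' _ _ _))// exprn_ege1.
Qed.

End hitting.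

(** * The multiple contour integral *)

Section contour_product.
Context {R : realType} (r : R).

Definition circle_cont (g : R[i] -> R[i]) : Prop :=
  ccont (fun u => g (circle r u) * ('i%C * circle r u)).

Lemma circle_integral_sum (I : Type) (s : seq I) (k : I -> R[i])
    (g : I -> R[i] -> R[i]) : (forall i, circle_cont (g i)) ->
  circle_integral r (fun z => \sum_(i <- s) k i * g i z)
    = \sum_(i <- s) k i * circle_integral r (g i).
Proof.
move=> cg; rewrite circle_integralE.
under eq_cintegral do [rewrite mulr_suml; under eq_bigr do rewrite -mulrA].
by rewrite (cintegral_sum _ _ _ _ k (fun i u => g i (circle r u) * ('i%C * circle r u))).
Qed.

(** By induction the inner variables are integrated with the factor in the outer variable absorbed
    into the coefficient [k i]; linearity of a single integral then treats the outer variable. *)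
Lemma circle_integrals_sum_prod (I : Type) (s : seq I) n (k : I -> R[i])
    (g : I -> 'I_n -> R[i] -> R[i]) : (forall i j, circle_cont (g i j)) ->
  circle_integrals r (fun xi : n.-tuple R[i] =>
    \sum_(i <- s) k i * \prod_(j < n) g i j (tnth xi j))
    = \sum_(i <- s) k i * \prod_(j < n) circle_integral r (g i j).
Proof.
elim: n k g => [|n IH] k g cg /=.
  by apply: eq_bigr => i _; rewrite !big_ord0.
transitivity (circle_integral r (fun z => \sum_(i <- s)
    (k i * \prod_(j < n) circle_integral r (g i (lift ord0 j))) * g i ord0 z)).
  congr circle_integral; apply/funext => z.
  under eq_bigr do rewrite mulrAC.
  rewrite -(IH (fun i => k i * g i ord0 z) (fun i j => g i (lift ord0 j)))//.
  congr circle_integrals; apply/funext => xi; apply: eq_bigr => i _.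
  rewrite big_ord_recl -mulrA tnth0; congr (_ * (_ * _)).
  by apply: eq_bigr => j _; rewrite tnthS.
rewrite circle_integral_sum//; apply: eq_bigr => i _.
by rewrite big_ord_recl -mulrA [_ * circle_integral _ _]mulrC.
Qed.

(* Andreief's identity for the monomials [z ^+ i]. *)
Lemma circle_integrals_Vandermonde n (w : R[i] -> R[i]) :
  (forall a : nat, circle_cont (fun z => z ^+ a * w z)) ->
  circle_integrals r (fun xi : n.-tuple R[i] =>
    (\prod_(i < n) \prod_(j < n | (i < j)%N) (tnth xi j - tnth xi i) ^+ 2) *
    \prod_(i < n) w (tnth xi i))
  = n`!%:R * \det (\matrix_(a < n, b < n)
      circle_integral r (fun z => z ^+ (a + b) * w z)).
Proof.
move=> cw; pose V (xi : n.-tuple R[i]) := Vandermonde n (\row_j tnth xi j).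
have detV xi : \prod_(i < n) \prod_(j < n | (i < j)%N)
    (tnth xi j - tnth xi i) ^+ 2 = (\det (V xi)) ^+ 2.
  rewrite det_Vandermonde -prodrXl; apply: eq_bigr => i _.
  by rewrite -prodrXl; apply: eq_bigr => j _; rewrite !mxE.
transitivity (circle_integrals r (fun xi : n.-tuple R[i] =>
    \sum_(st <- index_enum ('S_n * 'S_n)%type) (-1) ^+ st.1 * (-1) ^+ st.2 *
    \prod_(j < n) (tnth xi j ^+ (st.1 j + st.2 j) * w (tnth xi j)))).
  congr circle_integrals; apply/funext => xi.
  rewrite detV -det_tr expr2 /determinant !mulr_suml.
  under eq_bigr do rewrite mulr_sumr mulr_suml.
  rewrite pair_bigA /=; apply: eq_bigr => -[s t] _ /=.
  rewrite mulrACA -(mulrA ((-1) ^+ s * (-1) ^+ t)) -!big_split /=; congr (_ * _).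
  by apply: eq_bigr => j _; rewrite !mxE exprD.
rewrite (circle_integrals_sum_prod _ _ _
  (fun st : 'S_n * 'S_n => (-1) ^+ st.1 * (-1) ^+ st.2)
  (fun st j z => z ^+ (st.1 j + st.2 j) * w z)) => [|st j]; last exact: cw.
set H := (X in _ * \det X).
rewrite -(pair_bigA _ (fun s t : 'S_n => (-1) ^+ s * (-1) ^+ t *
  \prod_(j < n) circle_integral r (fun z => z ^+ (s j + t j) * w z))) /=.
rewrite -card_Sn mulr_natl -sumr_const; apply: eq_big => // s _.
(* With the second permutation written relative to [s], the signs of [s] cancel and each of the [n!]
   choices of [s] yields the same determinant. *)
rewrite (reindex_inj (mulgI s)) /determinant; apply: eq_bigr => t _.
rewrite odd_permM signr_addb mulrA -signr_addb addbb mul1r; congr (_ * _).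
rewrite [RHS](reindex_inj (@perm_inj _ s)); apply: eq_bigr => j _.
by rewrite mxE permM.
Qed.

End contour_product.

(** * The law of the process at a fixed time *)

Lemma probability_preimage_esum (R : realType) (d : measure_display)
    (Omega : measurableType d) (P : probability Omega R) (S : countType)
    (X : Omega -> S) (E : set S) :
  (forall s, measurable [set w | X w = s]) ->
  P [set w | E (X w)] = \esum_(s in E) P [set w | X w = s].
Proof.
(* The codes of the states index a countable partition of the event by natural numbers; codes
   outside the image of [E] give the empty set. *)
move=> mX; pose F (k : nat) := [set w | E (X w) /\ pickle (X w) = k].
have F_pickle s : E s -> F (pickle s) = [set w | X w = s].
  move=> Es; apply/seteqP; split=> w /= => [[_ /(pcan_inj pickleK)]|Xw]//.
  by rewrite /F /= Xw.
have F_out k : ~ (pickle @` E) k -> F k = set0.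
  by move=> kE; apply/seteqP; split=> // w [Ew wk]; apply: kE; exists (X w).
have mF k : measurable (F k).
  have [[s Es <-]|/F_out ->//] := pselect ((pickle @` E) k).
  by rewrite F_pickle.
have -> : [set w | E (X w)] = \bigcup_k F k.
  by apply/seteqP; split=> [w Ew|w [k _ []//]]; exists (pickle (X w)).
rewrite measure_bigcup//; last first.
  by move=> i j _ _ [w [[_ <-] [_ <-]]].
rewrite nneseries_esum// set_mem_set (esumID (pickle @` E))// !setTI.
rewrite [X in (_ + X)%E]esum1 ?adde0 => [|k /F_out ->]; last exact: measure0.
rewrite esum_image => [|s s' _ _]; last exact: (pcan_inj pickleK).
by apply: eq_esum => s Es; rewrite F_pickle.
Qed.

(** The Markov property is used with empty history at time 0; intersecting with the almost sure
    event [eta 0 = s0] does not change probabilities. *)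
Lemma markov_process_law (R : realType) (d : measure_display)
    (Omega : measurableType d) (P : probability Omega R) (S : countType)
    (Q : S -> S -> R) (s0 : S) (eta : R -> Omega -> S) :
  markov_process P Q s0 eta -> exists2 p, transition_function Q p &
    forall (t : R) s, 0 <= t -> P [set w | eta t w = s] = (p t s0 s)%:E.
Proof.
case=> meta P0 [p hp markov]; exists p => // t s t0.
have := markov [::] 0 t s0 s (lexx _) t0 isT; rewrite /= add0r.
set past := [set w | _].
have -> : past = setT by apply/seteqP; split=> // w _ us; rewrite in_nil.
rewrite !setTI P0 mul1e => <-.
rewrite [LHS](measureDI P (meta t s t0) (meta 0 s0 (lexx _))).
rewrite [X in (_ + P X)%E]setIC.
rewrite [X in (X + _)%E](_ : _ = 0%E) ?add0e//.
apply/eqP; rewrite eq_le measure_ge0 andbT.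
have <- : P (~` [set w | eta 0 w = s0]) = 0%E.
  rewrite probability_setC ?P0 ?subee//; exact: meta.
apply: le_measure; rewrite ?inE; last by move=> w [].
  by apply: measurableD; exact: meta.
by apply: measurableC; exact: meta.
Qed.

(** * Evaluation at the step initial condition *)

Section step_formula.
Context {R : realType} (r : R) (r_gt0 : 0 < r) (r_lt1 : r < 1).
Context (n : nat) (x : int) (t : R) (t_ge0 : 0 <= t).

Let w (z : R[i]) : R[i] := 1 / (z - 1) ^+ n *
  (z ^ (x - n.+1%:Z - 1) * cexp (epsilon z * t%:C)).

Let w_circle (a : nat) u : circle r u ^+ a * w (circle r u) * ('i%C * circle r u)
  = 'i%C * (-1) ^+ n * coef_integrand r (x - n.+1%:Z + a%:Z) (- n%:Z) t u.
Proof.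
have z0 := circle_neq0 r u r_gt0.
rewrite /w /coef_integrand; move: (circle r u) (cexp _) z0 => z E z0.
have -> : x - n.+1%:Z + a%:Z = (x - n.+1%:Z - 1) + a%:Z + 1 by ring.
rewrite [in RHS]expfzDr// [in RHS]expfzDr// expr1z -exprnP -exprnN.
rewrite -[z - 1]opprB (exprNn (1 - z)) div1r invfM -[(-1) ^- n]exprVn invrN1.
by move: (_ ^- n) => D; ring.
Qed.

(** The sign [(-1) ^+ n] comes from [(z - 1) ^+ n] against [(1 - z) ^+ n], and [2 pi i] from the
    normalisation of [contour_coef]. *)
Lemma circle_integral_moment (a : nat) :
  circle_integral r (fun z => z ^+ a * w z) = 2 * pi%:C * 'i%C * (-1) ^+ n *
    (rcoef r (x - n.+1%:Z + a%:Z) (- n%:Z) t)%:C.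
Proof.
rewrite -contour_coef_real// circle_integralE (eq_cintegral _ _ _ _ (w_circle a)).
rewrite cintegralZ; last exact: ccont_coef.
have qq : (2 * pi)%:C * (2 * pi)^-1%:C = 1 :> R[i].
  by rewrite -rmorphM mulfV// mulf_neq0// gt_eqF// pi_gt0.
rewrite /contour_coef (_ : 2 * pi%:C = (2 * pi)%:C); last first.
  by rewrite rmorphM rmorph_nat.
rewrite -[LHS]mul1r -qq.
by move: (2 * pi)%:C (2 * pi)^-1%:C (cintegral _ _ _) => q q' J; ring.
Qed.

Lemma killed_prob_step :
  (killed_prob (fun k m => rcoef r k m t) x (step_state n.+1))%:C =
  (-1) ^+ ((n.+1 * (n.+1 - 1)) %/ 2)%N / (n.+1)`!%:R *
  (1 / (2 * pi%:C * 'i%C)) ^+ n.+1 *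
  circle_integrals r (fun xi : n.+1.-tuple R[i] =>
    (\prod_(i < n.+1) \prod_(j < n.+1 | (i < j)%N) (tnth xi j - tnth xi i) ^+ 2) *
    \prod_(i < n.+1) w (tnth xi i)).
Proof.
rewrite circle_integrals_Vandermonde; last first.
  move=> a; rewrite /circle_cont; under [X in ccont X]eq_fun do rewrite w_circle.
  by apply: ccontM; [exact: ccont_cst|exact: ccont_coef].
pose H : 'M[R]_n.+1 :=
  \matrix_(a, b) rcoef r (x - n.+1%:Z + (a + b)%:Z) (- n%:Z) t.
rewrite (_ : \matrix_(a, b) _ =
    (2 * pi%:C * 'i%C * (-1) ^+ n) *: map_mx (real_complex R) H); last first.
  by apply/matrixP => a b; rewrite !mxE circle_integral_moment.
rewrite detZ det_map_mx /killed_prob eqxx [_ * killed_det _ _ _]mul1r.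
have -> : tnth (positions (step_state n.+1)) = fun i => i.+1%:Z.
  by apply/funext => i; rewrite tnth_mktuple.
rewrite killed_det_step => [|k m]; last exact: rcoef_rec.
rewrite rmorphM rmorphXn rmorphN1 divn2 subn1 -bin2.
have c0 : 2 * pi%:C * 'i%C != 0 :> R[i].
  rewrite mulf_neq0//; last by rewrite eq_complex /= oner_eq0 andbF.
  by rewrite mulf_neq0 ?pnatr_eq0// fmorph_eq0 gt_eqF// pi_gt0.
rewrite div1r exprVn; move: (2 * _ * _) c0 => c c0.
(* The signs of the [n + 1] rows multiply to [(-1) ^ (n (n + 1)) = 1], so only the sign of the row
   reversal remains. *)
rewrite exprMn -[(_ ^+ n) ^+ _]exprM -(signr_odd _ (n * _)) oddM andbN expr0 mulr1.
by field; rewrite pnatr_eq0 -lt0n fact_gt0 expf_neq0.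
Qed.

End step_formula.

Theorem corollary1p5 (R : realType) (d : measure_display)
    (Omega : measurableType d) (P : probability Omega R)
    (N : nat) (hN : (0 < N)%N) (eta : R -> Omega -> state N)
    (heta : tasep P (step_state N) eta)
    (x : int) (t : R) (ht : 0 <= t) (r : R) (hr0 : 0 < r) (hr1 : r < 1) :
  (fine (P [set w | word (eta t w) = word21 N /\
                    nth 0 (positions (eta t w)) 0 = x]))%:C =
  (-1) ^+ ((N * (N - 1)) %/ 2)%N / N`!%:R * (1 / (2 * pi%:C * 'i%C)) ^+ N *
  circle_integrals r (fun xi : N.-tuple R[i] =>
    (\prod_(i < N) \prod_(j < N | (i < j)%N) (tnth xi j - tnth xi i) ^+ 2) *
    (\prod_(i < N) (1 / (tnth xi i - 1) ^+ (N - 1))) *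
    \prod_(i < N) (tnth xi i ^ (x - N%:Z - 1) *
                   cexp (epsilon (tnth xi i) * t%:C))).

Proof.
case: N hN eta heta => // n _ eta heta.
have [p hp law] := markov_process_law _ _ _ _ _ _ _ _ heta.
have [meta _ _] := heta.
transitivity (hit R _ p (target n x) (step_state n.+1) t)%:C.
  congr (_%:C); rewrite /hit -(eq_esum (fun s _ => law t s ht)).
  by rewrite -probability_preimage_esum// => s; exact: meta.
rewrite (hit_killed_prob r hr0 hr1 n p hp x _ t ht) (killed_prob_step r hr0 hr1 n x t ht).
congr (_ * _); congr circle_integrals; apply/funext => xi.
by rewrite subn1 -[RHS]mulrA; congr (_ * _); rewrite -big_split.
Qed.
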